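(* Let $\lambda_1,\lambda_2\in[0,1]$ and consider the unitary almost Mathieu operators $W_{\lambda_1,\lambda_2,\alpha,\theta}$ on $\ell^2(\mathbb Z)\otimes\mathbb C^2$, for $\alpha\in[0,1]$ and $\theta\in\mathbb T$. The following assertions hold. (a) There exists a constant $C>0$ such that $$d_H\big(\sigma_{\lambda_1,\lambda_2,\alpha},\ \sigma_{\lambda_1,\lambda_2,\beta}\big)\le C|\alpha-\beta|^{1/2}\qquad\text{for all }\alpha,\beta\in[0,1].$$ (b) Let $\alpha\in[0,1]$. There exists a constant $C>0$ such that $$d_H\big(\sigma(W_{\lambda_1,\lambda_2,\alpha,\theta}),\ \sigma(W_{\lambda_1,\lambda_2,\alpha,\rho})\big)\le C|\theta-\rho|^{1/2}\qquad\text{for all }\theta,\rho\in\mathbb T.$$ (c) There exists a constant $C>0$, depending only on $\lambda_1,\lambda_2$, such that for all $\theta\in\mathbb T$, all $\alpha\in[0,1]$ and all $\beta=\frac pq\in[0,1]$ with $p,q$ coprime and $|\alpha-\beta|<\frac1{q^2}$, $$d_H\big(\sigma(W_{\lambda_1,\lambda_2,\alpha,\theta}),\ \sigma(W_{\lambda_1,\lambda_2,\beta,\theta})\big)\le\frac{C}{\sqrt q}.$$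
   Context: $\mathbb T$ is the torus, identified with $[0,1)$ with the metric $|\cdot|$. For $\lambda\in[0,1]$ write $\lambda'=\sqrt{1-\lambda^2}$. $d_H$ is the Hausdorff metric on compact subsets of $\mathbb C$ induced by the Euclidean metric. For $\psi=(\psi^+(n),\psi^-(n))_{n\in\mathbb Z}\in\ell^2(\mathbb Z)\otimes\mathbb C^2$ the unitary operator $W=W_{\lambda_1,\lambda_2,\alpha,\theta}$ is given, with $c_m=\cos(2\pi(m\alpha+\theta))$ and $s_m=\sin(2\pi(m\alpha+\theta))$, by $$(W\psi)^+(n)=\lambda_1\big((\lambda_2c_{n-1}+i\lambda_2')\psi^+(n-1)-\lambda_2s_{n-1}\psi^-(n-1)\big)-\lambda_1'\big(\lambda_2s_n\psi^+(n)+(\lambda_2c_n-i\lambda_2')\psi^-(n)\big),$$ $$(W\psi)^-(n)=\lambda_1\big(\lambda_2s_{n+1}\psi^+(n+1)+(\lambda_2c_{n+1}-i\lambda_2')\psi^-(n+1)\big)+\lambda_1'\big((\lambda_2c_n+i\lambda_2')\psi^+(n)-\lambda_2s_n\psi^-(n)\big).$$ For $\alpha\in[0,1]$ put $\sigma_{\lambda_1,\lambda_2,\alpha}:=\overline{\bigcup_{\theta\in\mathbb T}\sigma(W_{\lambda_1,\lambda_2,\alpha,\theta})}$. *)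

(* Defs.v *)
From HB Require Import structures.
From mathcomp Require Import all_boot all_order all_algebra.
From mathcomp Require Import complex.
From mathcomp Require Import all_classical all_reals all_analysis.
From mathcomp Require Import ring lra.

Set Implicit Arguments.
Unset Strict Implicit.
Unset Printing Implicit Defensive.

Import Order.TTheory GRing.Theory Num.Theory.
Import numFieldNormedType.Exports.
Import Normc.

Local Open Scope classical_set_scope.
Local Open Scope ring_scope.

Section l2.
Variables (R : realType) (I : choiceType).
Implicit Types (f g : I -> R[i]).

Definition sqnorm f : \bar R := \esum_(i in [set: I]) (normc (f i) ^+ 2)%:E.

Definition square_summable : {pred (I -> R[i])} :=
  [pred f | `[< (sqnorm f < +oo)%E >]].

Lemma square_summableP f : reflect (sqnorm f < +oo)%E (f \in square_summable).
Proof. by rewrite inE; exact: asboolP. Qed.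

Lemma sqnorm_ge0 f : (0 <= sqnorm f)%E.
Proof. by apply: esum_ge0 => i _; rewrite lee_fin sqr_ge0. Qed.

Lemma normc_ge0 (z : R[i]) : 0 <= normc z.
Proof. by case: z => a b; exact: sqrtr_ge0. Qed.

Lemma normc_triangle (z w : R[i]) : normc (z + w) <= normc z + normc w.
Proof. exact: (@le_normcD R z w). Qed.

Lemma sqnormZ_le (a : I -> R[i]) (M : R) f : (forall i, normc (a i) <= M) ->
  (sqnorm (fun i => a i * f i)%R <= (M ^+ 2)%:E * sqnorm f)%E.
Proof.
move=> aM; rewrite /sqnorm.
apply: ge_ereal_sup => _ [X [finX _] <-].
apply: (@le_trans _ _ ((M ^+ 2)%:E * (\sum_(i \in X) (normc (f i) ^+ 2)%:E))%E).
  rewrite ge0_mule_fsumr; last by move=> i; rewrite lee_fin sqr_ge0.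
  apply: lee_fsum => // i _; rewrite -EFinM lee_fin normcM exprMn.
  by rewrite ler_wpM2r ?sqr_ge0// lerXn2r ?nnegrE ?normc_ge0// (le_trans _ (aM i)) ?normc_ge0.
rewrite lee_wpmul2l ?lee_fin ?sqr_ge0//.
by apply: esum_ge; exists X.
Qed.

Lemma sqnormD_le (t : R) f g : 0 < t ->
  (sqnorm (fun i => f i + g i)%R <=
   (1 + t)%:E * sqnorm f + (1 + t^-1)%:E * sqnorm g)%E.
Proof.
move=> t0; have t'0 : 0 < t^-1 by rewrite invr_gt0.
rewrite /sqnorm; apply: ge_ereal_sup => _ [X [finX _] <-].
apply: (@le_trans _ _ ((1 + t)%:E * (\sum_(i \in X) (normc (f i) ^+ 2)%:E) +
    (1 + t^-1)%:E * (\sum_(i \in X) (normc (g i) ^+ 2)%:E))%E).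
  rewrite !ge0_mule_fsumr; try by move=> i; rewrite lee_fin sqr_ge0.
  rewrite -fsbig_split//=; apply: lee_fsum => // i _.
  rewrite -!EFinM -EFinD lee_fin.
  have h := normc_triangle (f i) (g i).
  have h0 := normc_ge0 (f i + g i).
  set x := normc (f i) in h *; set y := normc (g i) in h *.
  apply: (@le_trans _ _ ((x + y) ^+ 2)).
    by rewrite lerXn2r ?nnegrE// (le_trans h0).
  rewrite -subr_ge0.
  have -> : (1 + t) * x ^+ 2 + (1 + t^-1) * y ^+ 2 - (x + y) ^+ 2
    = t * (x - t^-1 * y) ^+ 2 by field; rewrite gt_eqF.
  by rewrite mulr_ge0 ?sqr_ge0 ?ltW.
apply: leeD; rewrite lee_wpmul2l// ?lee_fin ?addr_ge0// ?(ltW t0) ?(ltW t'0)//.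
  by apply: esum_ge; exists X.
by apply: esum_ge; exists X.
Qed.

Lemma square_summableM (a : I -> R[i]) (M : R) f :
  (forall i, normc (a i) <= M) ->
  f \in square_summable -> (fun i => a i * f i) \in square_summable.
Proof.
move=> aM /square_summableP fS; apply/square_summableP.
apply: (le_lt_trans (sqnormZ_le f aM)).
by rewrite lte_mul_pinfty ?lee_fin ?sqr_ge0.
Qed.

Lemma square_summableD f g : f \in square_summable -> g \in square_summable ->
  (fun i => f i + g i) \in square_summable.
Proof.
move=> /square_summableP fS /square_summableP gS; apply/square_summableP.
apply: (le_lt_trans (sqnormD_le f g ltr01)).
by apply: lte_add_pinfty; rewrite lte_mul_pinfty ?lee_fin ?addr_ge0// invr_ge0.
Qed.

Lemma square_summable_reindex (e : I -> I) f : bijective e ->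
  f \in square_summable -> (fun i => f (e i)) \in square_summable.
Proof.
move=> bij_e /square_summableP fS; apply/square_summableP.
rewrite /sqnorm -(@reindex_esum R I I setT setT e (fun i => (normc (f i) ^+ 2)%:E))//.
by rewrite setTT_bijective.
Qed.

Lemma square_summable_subsemimod : subsemimod_closed square_summable.
Proof.
split; first split.
- apply/square_summableP; rewrite /sqnorm esum1// => i _.
  by rewrite normc0 expr0n.
- by move=> f g fS gS; exact: square_summableD.
- by move=> a f fS; apply: (@square_summableM (fun=> a) (normc a)).
Qed.

Record l2 := L2 { l2_val :> I -> R[i]; _ : l2_val \in square_summable }.

HB.instance Definition _ := [isSub for l2_val].
HB.instance Definition _ := [Choice of l2 by <:].
HB.instance Definition _ := GRing.SubChoice_isSubLmodule.Build
  R[i] (I -> R[i]) square_summable l2 square_summable_subsemimod.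

(* Norms over the scalar field R[i] are R[i]-valued. *)
Definition l2_norm (f : l2) : R[i] := (Num.sqrt (fine (sqnorm f)))%:C%C.

Lemma sqnorm_fin (f : l2) : sqnorm f \is a fin_num.
Proof.
rewrite ge0_fin_numE ?sqnorm_ge0//.
by apply/square_summableP; case: f.
Qed.

Lemma fine_sqnorm_ge0 (f : l2) : 0 <= fine (sqnorm f).
Proof. by rewrite fine_ge0// sqnorm_ge0. Qed.

Lemma sqnorm_eq0 (f : l2) : fine (sqnorm f) = 0 -> f = 0.
Proof.
move=> f0; have {}f0 : sqnorm f = 0%E by rewrite -(fineK (sqnorm_fin f)) f0.
apply/val_inj/funext => i /=; apply/eq0_normc/eqP.
rewrite -sqrf_eq0 eq_le sqr_ge0 andbT -lee_fin.
rewrite -[leRHS]f0; apply: esum_ge; exists [set i]; first by split.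
by rewrite fsbig_set1.
Qed.

Lemma l2_ler_normD (f g : l2) : l2_norm (f + g) <= l2_norm f + l2_norm g.
Proof.
rewrite /l2_norm -rmorphD/= lecR.
set a := fine (sqnorm f); set b := fine (sqnorm g).
have a0 : 0 <= a := fine_sqnorm_ge0 f.
have b0 : 0 <= b := fine_sqnorm_ge0 g.
have [a_eq0|a_neq0] := eqVneq a 0.
  by rewrite a_eq0 sqrtr0 add0r (sqnorm_eq0 a_eq0) add0r.
have [b_eq0|b_neq0] := eqVneq b 0.
  by rewrite b_eq0 sqrtr0 addr0 (sqnorm_eq0 b_eq0) addr0.
have sa : 0 < Num.sqrt a by rewrite sqrtr_gt0 lt_neqAle eq_sym a_neq0.
have sb : 0 < Num.sqrt b by rewrite sqrtr_gt0 lt_neqAle eq_sym b_neq0.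
have t0 : 0 < Num.sqrt b / Num.sqrt a by rewrite divr_gt0.
have := sqnormD_le f g t0.
rewrite -(fineK (sqnorm_fin f)) -(fineK (sqnorm_fin g)) -/a -/b.
rewrite -(fineK (sqnorm_fin (f + g))) -!EFinM -EFinD lee_fin => le_ab.
rewrite -[leRHS]ger0_norm ?addr_ge0 ?sqrtr_ge0// -sqrtr_sqr /=.
apply: ler_wsqrtr; apply: (le_trans le_ab); rewrite le_eqVlt; apply/orP; left.
move: sa sb; set sa := Num.sqrt a; set sb := Num.sqrt b => sa0 sb0.
have -> : a = sa ^+ 2 by rewrite sqr_sqrtr.
have -> : b = sb ^+ 2 by rewrite sqr_sqrtr.
by apply/eqP; field; rewrite !gt_eqF.
Qed.

Lemma l2_normrZ (z : R[i]) (f : l2) : l2_norm (z *: f) = `|z| * l2_norm f.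
Proof.
have Hz w (g : l2) : fine (sqnorm (l2_val (w *: g))) <= normc w ^+ 2 * fine (sqnorm g).
  have := @sqnormZ_le (fun=> w) (normc w) g (fun=> lexx _).
  by rewrite -(fineK (sqnorm_fin g)) -(fineK (sqnorm_fin (w *: g))) -EFinM lee_fin.
have -> : `|z| = (normc z)%:C%C by rewrite normc_def; case: z.
rewrite /l2_norm -rmorphM/=; congr (_%:C)%C.
rewrite -[X in _ = X * _]ger0_norm ?normc_ge0// -sqrtr_sqr -sqrtrM ?sqr_ge0//.
congr Num.sqrt; apply/eqP; rewrite eq_le Hz/=.
have [z0|z0] := eqVneq z 0.
  have -> : normc z = 0 by rewrite z0; exact: normc0.
  by rewrite expr0n mul0r; exact: (fine_sqnorm_ge0 (z *: f)).
have nz0 : normc z != 0 by apply: contra z0 => /eqP/eq0_normc ->.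
have := Hz z^-1 (z *: f); rewrite scalerA mulVf// scale1r normcV exprVn => H.
rewrite mulrC -ler_pdivlMr ?exprn_gt0// ?lt_neqAle 1?eq_sym ?nz0 ?normc_ge0//.
by rewrite mulrC.
Qed.

Lemma l2_norm_eq0 (f : l2) : l2_norm f = 0 -> f = 0.
Proof.
move=> /(congr1 (@complex.Re R))/= /eqP; rewrite sqrtr_eq0 => f0.
by apply: sqnorm_eq0; apply/eqP; rewrite eq_le f0 fine_sqnorm_ge0.
Qed.

HB.instance Definition _ := Lmodule_isNormed.Build R[i] l2
  l2_ler_normD l2_normrZ l2_norm_eq0.

End l2.

Definition resolvent_set (K : numFieldType) (V : normedModType K)
    (T : V -> V) : set K :=
  [set z | exists S : {linear V -> V},
    [/\ continuous S,
        cancel (fun x => T x - z *: x) S &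
        cancel S (fun x => T x - z *: x)]].

Definition spectrum (K : numFieldType) (V : normedModType K)
    (T : V -> V) : set K := ~` resolvent_set T.

(* Extended-real valued, so that an upper bound is a genuine one even before the
   sets are known to be nonempty and bounded. *)
Definition hausdorff_dist (R : realType) (A B : set R[i]) : \bar R :=
  Order.max
    (ereal_sup [set ereal_inf [set (normc (a - b))%:E | b in B] | a in A])
    (ereal_sup [set ereal_inf [set (normc (a - b))%:E | a in A] | b in B]).

Section uamo.
Variable R : realType.
Variables lambda1 lambda2 alpha theta : R.
Local Open Scope complex_scope.

(* The lambda' of the parameter lambda. *)
Definition colambda (l : R) : R := Num.sqrt (1 - l ^+ 2).

Definition uamo_cos (m : int) : R := cos (2 * pi * (m%:~R * alpha + theta)).
Definition uamo_sin (m : int) : R := sin (2 * pi * (m%:~R * alpha + theta)).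

(* l^2(Z) (x) C^2 is realized as l^2(Z x {+,-}), with [true] for + and [false]
   for -, so that psi^+(n) is [psi (n, true)] and psi^-(n) is [psi (n, false)]. *)
Definition uamo_fun (psi : int * bool -> R[i]) : int * bool -> R[i] :=
  let c := uamo_cos in
  let s := uamo_sin in
  let lambda1' := colambda lambda1 in
  let lambda2' := colambda lambda2 in
  let psip n := psi (n, true) in
  let psim n := psi (n, false) in
  fun '(n, b) =>
    if b then
      lambda1%:C * ((lambda2 * c (n - 1) +i* lambda2') * psip (n - 1)
                    - (lambda2 * s (n - 1))%:C * psim (n - 1))
      - lambda1'%:C * ((lambda2 * s n)%:C * psip n
                       + (lambda2 * c n -i* lambda2') * psim n)
    else
      lambda1%:C * ((lambda2 * s (n + 1))%:C * psip (n + 1)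
                    + (lambda2 * c (n + 1) -i* lambda2') * psim (n + 1))
      + lambda1'%:C * ((lambda2 * c n +i* lambda2') * psip n
                       - (lambda2 * s n)%:C * psim n).

Lemma uamo_fun_square_summable psi :
  psi \in @square_summable R (int * bool)%type ->
  uamo_fun psi \in @square_summable R (int * bool)%type.
Proof.
move=> psiS.
set l1' := colambda lambda1; set l2' := colambda lambda2.
pose tau (k : int) (b : bool) (i : int * bool) := (i.1 + k, i.2 (+) b).
have tau_bij k b : bijective (tau k b).
  exists (tau (- k) b) => -[n s]; rewrite /tau/=.
    by rewrite addrK -addbA addbb addbF.
  by rewrite subrK -addbA addbb addbF.
have term k b (l x y : int * bool -> R) : (forall i, `|l i| <= `|lambda1| + `|l1'|) ->
    (forall i, `|x i| <= `|lambda2|) -> (forall i, `|y i| <= `|l2'|) ->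
    (fun i => (l i)%:C * (x i +i* y i) * psi (tau k b i)) \in
      @square_summable R (int * bool)%type.
  move=> lb xb yb.
  apply: (@square_summableM _ _ (fun i => (l i)%:C * (x i +i* y i))
    ((`|lambda1| + `|l1'|) * (`|lambda2| + `|l2'|)) (psi \o tau k b)).
    move=> i; rewrite normcM ler_pM ?normc_ge0//.
      by rewrite /= expr0n addr0 sqrtr_sqr.
    have -> : x i +i* y i = (x i)%:C + (0 +i* y i) by simpc.
    apply: (le_trans (normc_triangle _ _)); apply: lerD.
      by rewrite /= expr0n addr0 sqrtr_sqr.
    by rewrite /= expr0n add0r sqrtr_sqr.
  exact: square_summable_reindex.
have cb m : `|lambda2 * uamo_cos m| <= `|lambda2|.
  by rewrite normrM ler_piMr// ler_norml cos_geN1 cos_le1.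
have sb m : `|lambda2 * uamo_sin m| <= `|lambda2|.
  by rewrite normrM ler_piMr// ler_norml sin_geN1 sin_le1.
have H1 : `|lambda1| <= `|lambda1| + `|l1'| by rewrite lerDl.
have H2 : `|l1'| <= `|lambda1| + `|l1'| by rewrite lerDr.
have H0 : `|0 : R| <= `|lambda1| + `|l1'| by rewrite normr0 addr_ge0.
have Z x : `|0 : R| <= `|x : R| by rewrite normr0.
have S0 := @term 0 false (fun=> - l1')
  (fun i => lambda2 * uamo_sin i.1) (fun=> 0)
  ltac:(by move=> i; rewrite normrN) ltac:(by []) ltac:(by []).
have S1 := @term 0 true (fun i : int * bool => if i.2 then - l1' else l1')
  (fun i => lambda2 * uamo_cos i.1) (fun i => if i.2 then - l2' else l2')
  ltac:(by move=> -[n []]//=; rewrite normrN) ltac:(by [])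
  ltac:(by move=> -[n []]//=; rewrite normrN).
have S2 := @term (-1) false (fun i : int * bool => if i.2 then lambda1 else 0)
  (fun i => lambda2 * uamo_cos (i.1 - 1)) (fun=> l2')
  ltac:(by move=> -[n []]) ltac:(by []) ltac:(by []).
have S3 := @term (-1) true (fun i : int * bool => if i.2 then - lambda1 else 0)
  (fun i => lambda2 * uamo_sin (i.1 - 1)) (fun=> 0)
  ltac:(by move=> -[n []]//=; rewrite normrN) ltac:(by []) ltac:(by []).
have S4 := @term 1 true (fun i : int * bool => if i.2 then 0 else lambda1)
  (fun i => lambda2 * uamo_sin (i.1 + 1)) (fun=> 0)
  ltac:(by move=> -[n []]) ltac:(by []) ltac:(by []).
have S5 := @term 1 false (fun i : int * bool => if i.2 then 0 else lambda1)
  (fun i => lambda2 * uamo_cos (i.1 + 1)) (fun=> - l2')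
  ltac:(by move=> -[n []]) ltac:(by []) ltac:(by move=> i; rewrite normrN).
have := square_summableD (square_summableD (square_summableD S0 S1)
  (square_summableD S2 S3)) (square_summableD S4 S5).
set F := (X in X \in _); have -> // : uamo_fun psi = F.
apply/funext => -[n []]; rewrite /F /uamo_fun /tau/= addr0 -/l1' -/l2'.
  case: (psi (n - 1, true)) => a1 b1; case: (psi (n - 1, false)) => a2 b2.
  case: (psi (n, true)) => a3 b3; case: (psi (n, false)) => a4 b4.
  case: (psi (n + 1, true)) => a5 b5; case: (psi (n + 1, false)) => a6 b6.
  by apply/eqP; rewrite eq_complex /=; apply/andP; split; apply/eqP; ring.
case: (psi (n - 1, true)) => a1 b1; case: (psi (n - 1, false)) => a2 b2.
case: (psi (n, true)) => a3 b3; case: (psi (n, false)) => a4 b4.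
case: (psi (n + 1, true)) => a5 b5; case: (psi (n + 1, false)) => a6 b6.
by apply/eqP; rewrite eq_complex /=; apply/andP; split; apply/eqP; ring.
Qed.

Definition uamo (psi : l2 R (int * bool)%type) : l2 R (int * bool)%type :=
  L2 (uamo_fun_square_summable (valP psi)).

End uamo.

(* The torus is identified with the interval [0, 1). *)
Definition uamo_spectrum (R : realType) (lambda1 lambda2 alpha : R) : set R[i] :=
  closure (\bigcup_(theta in `[0, 1[) spectrum (uamo lambda1 lambda2 alpha theta)).

(* Main.v *)
From HB Require Import structures.
Require Import Defs.
From mathcomp Require Import all_boot all_order all_algebra.
From mathcomp Require Import complex.
From mathcomp Require Import all_classical all_reals all_analysis.
From mathcomp Require Import zify ring lra.

(** Two facts about a unitary [U] turn the statement into a problem about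
    approximate eigenvectors. Every [z] in the spectrum has them: for each
    [e > 0] some [x] satisfies [`|U x - z x| < e `|x|]
    ([spectrum_approx_eigenvector]). Conversely, if [`|U x - z x| <= r `|x|]
    for a single nonzero [x] and [z] on the unit circle, then the spectrum
    meets the disc of radius [r] around [z]
    ([spectrum_near_approx_eigenvector]). The converse is obtained from the
    bottom [mu] of the positive operator [H = (U - z)^* (U - z)]: up to an
    invertible factor, [H - mu] is [(U - z w1) (U - z w2)] with [w1], [w2] the
    two points of the unit circle at distance [sqrt mu <= r] from 1, and it is
    not bounded below, so one factor is not invertible.

    The walk moves amplitudes by at most one site. Multiplying an approximate
    eigenvector by a tent of half-width [L] therefore costs an error of order
    [1 / L], provided that the centre [m] of the tent is well chosen, which is
    possible on average over all centres ([localized_approx_eigenvector]).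
    On a window of half-width [L] around [m], the phases
    [n alpha + theta] and the phases of the parameters [(beta, theta')] around
    another centre [m'] differ modulo 1 by at most
    [delta + L `|alpha - beta|], where [delta] is the mismatch of the phases at
    the two centres. So the translated cut-off vector is an approximate
    eigenvector for [(beta, theta')], and the spectrum of that walk comes
    within [7 / L + 4 pi (delta + L `|alpha - beta|)] of [z]
    ([spectrum_transfer]).

    The three bounds are choices of parameters. For the union over all phases,
    [theta'] can be chosen so that [delta = 0], and [L] is about
    [`|alpha - beta|^(-1/2)]. For a fixed frequency, [m' = m],
    [delta = `|theta - rho|] and [L] is at least [1 / delta]; this gives a
    Lipschitz bound, stronger than the one asserted. For [beta = p / q] take
    [L = q]: since the multiples of [p / q] are all the multiples of [1 / q]
    modulo 1, the centre [m'] can be chosen with [delta <= 1 / q]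
    ([near_rational]), and in the other direction one may take [m'] to be the
    residue of [m] modulo [q], because then
    [m' `|alpha - beta| <= q / q^2] ([rational_near]). *)

Set Implicit Arguments.
Unset Strict Implicit.
Unset Printing Implicit Defensive.
Import Order.TTheory GRing.Theory Num.Theory.
Import numFieldNormedType.Exports.
Import Normc.
Local Open Scope classical_set_scope.
Local Open Scope ring_scope.

(** * Squared norm and real inner product *)

Section SquaredNorm.
Variables (R : realType) (I : choiceType).
Implicit Types (f g h : l2 R I) (z : R[i]).

Lemma normc_sqr z : normc z ^+ 2 = complex.Re z ^+ 2 + complex.Im z ^+ 2.
Proof. by case: z => a b /=; rewrite sqr_sqrtr// addr_ge0 ?sqr_ge0. Qed.

Lemma normcC (x : R) : normc (x%:C)%C = `|x|.
Proof. by rewrite /= expr0n addr0 sqrtr_sqr. Qed.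

Lemma l2_addE f g i : (f + g) i = f i + g i.
Proof. by []. Qed.

Lemma l2_scaleE z f i : (z *: f) i = z * f i.
Proof. by []. Qed.

Definition nsq f : R := fine (sqnorm f).

Lemma nsqE f : (nsq f)%:E = sqnorm f.
Proof. by rewrite /nsq fineK// sqnorm_fin. Qed.

Lemma nsq_ge0 f : 0 <= nsq f.
Proof. exact: fine_sqnorm_ge0. Qed.

Lemma nsq0 : nsq 0 = 0.
Proof.
by apply: EFin_inj; rewrite nsqE /sqnorm esum1// => i _; rewrite normc0 expr0n.
Qed.

Lemma nsq_gt0 f : f != 0 -> 0 < nsq f.
Proof.
move=> f0; rewrite lt_neqAle nsq_ge0 andbT eq_sym.
by apply: contra f0 => /eqP /sqnorm_eq0 ->.
Qed.

Lemma l2_normE f : `|f| = (Num.sqrt (nsq f))%:C%C.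
Proof. by []. Qed.

Lemma sqrt_nsqD f g :
  Num.sqrt (nsq (f + g)) <= Num.sqrt (nsq f) + Num.sqrt (nsq g).
Proof. by have := l2_ler_normD f g; rewrite /l2_norm -rmorphD/= lecR. Qed.

Lemma nsqZ z f : nsq (z *: f) = normc z ^+ 2 * nsq f.
Proof.
apply: EFin_inj; rewrite nsqE EFinM nsqE; apply/eqP; rewrite eq_le.
rewrite (sqnormZ_le (a := fun=> z))//=.
have [->|z0] := eqVneq z 0.
  by rewrite normc0 expr0n mul0e sqnorm_ge0.
have nz0 : normc z != 0 by apply: contra z0 => /eqP/eq0_normc ->.
(* The reverse inequality is the direct one for [z^-1] and [z *: f]. *)
have := @sqnormZ_le R I (fun=> z^-1) (normc z^-1) (z *: f) (fun=> lexx _).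
have -> : sqnorm (fun i => z^-1 * (z *: f) i) = sqnorm f.
  by congr sqnorm; apply/funext => i /=; rewrite mulrA mulVf// mul1r.
rewrite -!nsqE -!EFinM !lee_fin normcV exprVn => H.
rewrite mulrC -ler_pdivlMr; first by rewrite mulrC.
by rewrite exprn_gt0// lt_neqAle eq_sym nz0 normc_ge0.
Qed.

Lemma nsqN f : nsq (- f) = nsq f.
Proof. by rewrite -scaleN1r nsqZ normcN normc1 expr1n mul1r. Qed.

Lemma nsqD_le f g : nsq (f + g) <= 2 * nsq f + 2 * nsq g.
Proof.
have := @sqnormD_le R I 1 f g ltr01.
by rewrite invr1 -(nsqE (f + g)) -(nsqE f) -(nsqE g).
Qed.

(** This identity is the additivity of the polarization [ip]. Every term has
    coefficient one, so it can be summed coordinatewise in [[0, +oo]]. *)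
Lemma nsqDDD f g h : nsq (f + g + h) + (nsq f + (nsq g + nsq h)) =
  nsq (f + g) + (nsq (f + h) + nsq (g + h)).
Proof.
apply: EFin_inj; rewrite !EFinD !nsqE /sqnorm.
rewrite -!esumD; try by move=> *; rewrite -?EFinD lee_fin ?addr_ge0 ?sqr_ge0.
apply: eq_esum => i _; rewrite -!EFinD; congr EFin.
rewrite !normc_sqr ?(l2_addE, l2_scaleE).
case: (f i) (g i) (h i) => [a b] [c d] [k l] /=; ring.
Qed.

(** Homogeneity of [ip] over the nonnegative reals, again arranged without
    subtraction so that it can be summed coordinatewise. *)
Lemma nsq_affine (t : R) f g : 0 <= t ->
  nsq (t%:C%C *: f + g) + (t * nsq f + t * nsq g) =
  t * nsq (f + g) + (t ^+ 2 * nsq f + nsq g).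
Proof.
have sc (s : R) (k : l2 R I) : 0 <= s -> s ^+ 2 * nsq k = nsq (s%:C%C *: k).
  by move=> s0; rewrite nsqZ normcC ger0_norm.
move=> t0; have [s s0 ->] : exists2 s : R, 0 <= s & t = s ^+ 2.
  by exists (Num.sqrt t); rewrite ?sqrtr_ge0 ?sqr_sqrtr.
rewrite !sc ?sqr_ge0//.
apply: EFin_inj; rewrite !EFinD !nsqE /sqnorm.
rewrite -!esumD; try by move=> *; rewrite -?EFinD lee_fin ?addr_ge0 ?sqr_ge0.
apply: eq_esum => i _; rewrite -!EFinD; congr EFin.
rewrite !normc_sqr ?(l2_addE, l2_scaleE).
case: (f i) (g i) => [a b] [c d] /=; ring.
Qed.

(** The real part of the inner product, by polarization: minimizing a quadratic
    form along real lines uses only this part. *)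
Definition ip f g : R := (nsq (f + g) - nsq f - nsq g) / 2.

Lemma nsqD f g : nsq (f + g) = nsq f + nsq g + 2 * ip f g.
Proof. by rewrite /ip; field. Qed.

Lemma ipC f g : ip f g = ip g f.
Proof. by rewrite /ip (addrC f) addrAC. Qed.

Lemma ipDl f g h : ip (f + g) h = ip f h + ip g h.
Proof. by have := nsqDDD f g h; rewrite /ip => H; lra. Qed.

Lemma ipDr f g h : ip h (f + g) = ip h f + ip h g.
Proof. by rewrite ![ip h _]ipC ipDl. Qed.

Lemma ipff f : ip f f = nsq f.
Proof.
have -> : ip f f = (nsq ((1 + 1) *: f) - nsq f - nsq f) / 2.
  by rewrite scalerDl scale1r.
rewrite nsqZ.
by rewrite -[1 + 1]/((1 + 1) +i* (0 + 0))%C normc_sqr /=; field.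
Qed.

Lemma ip0l g : ip 0 g = 0.
Proof. by rewrite /ip add0r nsq0; ring. Qed.

Lemma ipNl f g : ip (- f) g = - ip f g.
Proof. by have := ipDl f (- f) g; rewrite subrr ip0l => H; lra. Qed.

Lemma ipNr f g : ip g (- f) = - ip g f.
Proof. by rewrite ![ip g _]ipC ipNl. Qed.

Lemma ipZl (t : R) f g : 0 <= t -> ip (t%:C%C *: f) g = t * ip f g.
Proof.
move=> t0; have := nsq_affine f g t0.
by rewrite /ip nsqZ normcC real_normK ?num_real// => H; lra.
Qed.

Lemma ip_isometry (U : l2 R I -> l2 R I) f g : {morph U : x y / x + y} ->
  (forall x, nsq (U x) = nsq x) -> ip (U f) (U g) = ip f g.
Proof. by move=> Ul Ui; rewrite /ip -Ul !Ui. Qed.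

End SquaredNorm.

(** * Completeness and perturbation of surjections *)

Section Completeness.
Variables (R : realType) (I : choiceType).
Implicit Types (f g h : l2 R I) (z : R[i]).

Definition nrm f : R := Num.sqrt (nsq f).

Lemma nrm_ge0 f : 0 <= nrm f.
Proof. exact: sqrtr_ge0. Qed.

Lemma nrm_sqr f : nrm f ^+ 2 = nsq f.
Proof. by rewrite sqr_sqrtr ?nsq_ge0. Qed.

Lemma nrmD f g : nrm (f + g) <= nrm f + nrm g.
Proof. exact: sqrt_nsqD. Qed.

Lemma nrm_leP f (e : R) : 0 <= e -> (nrm f <= e) = (nsq f <= e ^+ 2).
Proof. by move=> e0; rewrite -nrm_sqr ler_pXn2r ?nnegrE ?nrm_ge0. Qed.

Lemma normc_le_nrm f i : normc (f i) <= nrm f.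
Proof.
rewrite -(ler_pXn2r (n := 2)) ?nnegrE ?nrm_ge0 ?normc_ge0// nrm_sqr.
rewrite -lee_fin nsqE; apply: esum_ge; exists [set i]; first by split.
by rewrite fsbig_set1.
Qed.

Lemma Re_le_normc z : `|complex.Re z| <= normc z.
Proof.
case: z => a b /=; rewrite -sqrtr_sqr ler_wsqrtr// lerDl; exact: sqr_ge0.
Qed.

Lemma Im_le_normc z : `|complex.Im z| <= normc z.
Proof.
case: z => a b /=; rewrite -sqrtr_sqr ler_wsqrtr// lerDr; exact: sqr_ge0.
Qed.

Lemma cauchy_seq_cvg (v : nat -> R) :
  (forall e : R, 0 < e -> exists N, forall n m, (N <= n)%N -> (N <= m)%N ->
    `|v n - v m| <= e) -> cvgn v.
Proof.
move=> vC; apply/cauchy_cvgP; apply: cauchy_exP => e e0.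
have [N NP] := vC _ (divr_gt0 e0 (ltr0Sn _ 1)).
exists (v N); exists N => // n /= Nn; rewrite /ball /=.
by apply: le_lt_trans (NP _ _ (leqnn N) Nn) _; rewrite ltr_pdivrMr// ltr_pMr// ltr1n.
Qed.

Lemma cvg_bigsum (s : seq I) (F : nat -> I -> R) (G : I -> R) :
  (forall i, F n i @[n --> \oo] --> G i) ->
  (\sum_(i <- s) F n i) @[n --> \oo] --> \sum_(i <- s) G i.
Proof.
move=> FG; elim: s => [|i s IH].
  by rewrite big_nil; under eq_fun do rewrite big_nil; exact: cvg_cst.
by rewrite big_cons; under eq_fun do rewrite big_cons; exact: cvgD.
Qed.

(** The limit is taken coordinatewise. Each finite partial sum of
    [`|u n - u m|^2] is at most [e^2] and passes to the limit in [m], which bounds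
    the whole sum. *)
Lemma l2_complete (u : nat -> l2 R I) :
  (forall e : R, 0 < e -> exists N, forall n m, (N <= n)%N -> (N <= m)%N ->
    nrm (u n - u m) <= e) ->
  exists l, forall e : R, 0 < e -> exists N, forall n, (N <= n)%N ->
    nrm (u n - l) <= e.
Proof.
move=> uC.
have cvRe i : cvgn (fun n => complex.Re (u n i)).
  apply: cauchy_seq_cvg => e /uC[N NP]; exists N => n m Nn Nm.
  apply: le_trans (NP n m Nn Nm); apply: le_trans (normc_le_nrm _ i).
  by apply: le_trans (Re_le_normc _); rewrite raddfB.
have cvIm i : cvgn (fun n => complex.Im (u n i)).
  apply: cauchy_seq_cvg => e /uC[N NP]; exists N => n m Nn Nm.
  apply: le_trans (NP n m Nn Nm); apply: le_trans (normc_le_nrm _ i).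
  by apply: le_trans (Im_le_normc _); rewrite raddfB.
pose l i : R[i] := (limn (fun n => complex.Re (u n i)) +i*
                    limn (fun n => complex.Im (u n i)))%C.
have key (e : R) : 0 < e -> exists N, forall n, (N <= n)%N ->
    (sqnorm (fun i => u n i - l i)%R <= (e ^+ 2)%:E)%E.
  move=> e0; have [N NP] := uC _ e0; exists N => n Nn.
  apply: ge_ereal_sup => _ [X [finX _] <-].
  rewrite fsbig_finite//= sumEFin lee_fin.
  have H i : normc (u n i - u m i) ^+ 2 @[m --> \oo] --> normc (u n i - l i) ^+ 2.
    rewrite normc_sqr !raddfB /=; under eq_fun do rewrite normc_sqr !raddfB /=.
    by apply: cvgD; rewrite expr2; under eq_fun do rewrite expr2;
      apply: cvgM; apply: cvgB => //; exact: cvg_cst.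
  apply: (cvgr_to_le (cvg_bigsum H)); exists N => // m /= Nm.
  have := NP _ _ Nn Nm; rewrite (nrm_leP _ (ltW e0)) -lee_fin nsqE => uX.
  rewrite -lee_fin; apply: le_trans uX.
  apply: esum_ge; exists X; first by split.
  by rewrite fsbig_finite//= sumEFin.
have [N NP] := key _ ltr01.
have lS : l \in square_summable (R := R) (I := I).
  have h : (fun i => u N i - l i) \in square_summable (R := R) (I := I).
    by apply/square_summableP; apply: le_lt_trans (NP _ (leqnn _)) _; rewrite ltry.
  rewrite [l](_ : _ = fun i => u N i + -1 * (u N i - l i)).
    apply: square_summableD; first exact: valP.
    apply: (@square_summableM R I (fun=> -1) 1 (fun i => u N i - l i) _ h).
    by move=> i; rewrite normcN normc1.
  by apply/funext => i; rewrite mulN1r opprB addrC subrK.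
exists (L2 lS) => e e0; have [M MP] := key _ e0; exists M => n Mn.
by rewrite (nrm_leP _ (ltW e0)) -lee_fin nsqE; exact: MP.
Qed.

(** The solution is the fixed point of [x |-> T^-1 (y + B x)], a contraction of
    ratio [b / c]. *)
Lemma surjective_perturbation (T B : l2 R I -> l2 R I) (b c : R) :
  {morph T : x y / x - y} -> {morph B : x y / x - y} ->
  (forall y, exists x, T x = y) ->
  0 <= b < c -> (forall x, c * nrm x <= nrm (T x)) ->
  (forall x, nrm (B x) <= b * nrm x) ->
  forall y, exists x, T x - B x = y.
Proof.
move=> TB BB Tsurj /andP[b0 bc] Tc Bb y.
have c0 : 0 < c by apply: le_lt_trans bc.
have [G TG] := choice Tsurj.
pose r := b / c.
have r0 : 0 <= r by rewrite divr_ge0// ltW.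
have r1 : r < 1 by rewrite ltr_pdivrMr// mul1r.
pose Phi x := G (y + B x).
have contr x x' : nrm (Phi x - Phi x') <= r * nrm (x - x').
  rewrite /r mulrAC ler_pdivlMr// mulrC (le_trans (Tc _))// TB !TG.
  by rewrite opprD addrACA subrr add0r -BB.
pose u n := iter n Phi 0.
pose s := nrm (u 1%N - u 0%N).
have step n : nrm (u n.+1 - u n) <= s * r ^+ n.
  elim: n => [|n IH]; first by rewrite mulr1.
  by rewrite (le_trans (contr _ _))// exprS mulrCA ler_wpM2l.
have tail n k : nrm (u (n + k)%N - u n) * (1 - r) <= s * r ^+ n * (1 - r ^+ k).
  elim: k => [|k IH].
    by rewrite addn0 subrr /nrm nsq0 sqrtr0 mul0r expr0 subrr mulr0.
  rewrite addnS -(subrK (u (n + k)%N) (u (n + k).+1)) -addrA.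
  apply: (@le_trans _ _ ((s * r ^+ (n + k) + nrm (u (n + k)%N - u n)) * (1 - r))).
    rewrite ler_wpM2r ?subr_ge0 ?(ltW r1)// (le_trans (nrmD _ _))// lerD2r.
    exact: step.
  rewrite mulrDl; apply: (le_trans (lerD (lexx _) IH)).
  by rewrite exprD exprS le_eqVlt; apply/orP; left; apply/eqP; ring.
have s0 : 0 <= s by exact: nrm_ge0.
have tail' n m : (n <= m)%N -> nrm (u m - u n) <= s / (1 - r) * r ^+ n.
  move=> nm; have := tail n (m - n)%N; rewrite subnKC// => h.
  rewrite mulrAC ler_pdivlMr ?subr_gt0// (le_trans h)//.
  by rewrite ler_piMr ?mulr_ge0 ?exprn_ge0// gerBl exprn_ge0.
have nrmC (f g : l2 R I) : nrm (f - g) = nrm (g - f) by rewrite /nrm -nsqN opprB.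
have small (e : R) : 0 < e -> exists N, s / (1 - r) * r ^+ N <= e.
  move=> e0.
  have : (s / (1 - r) * r ^+ n) @[n --> \oo] --> (0 : R).
    rewrite -[0 : R](mulr0 (s / (1 - r))); apply: cvgM; first exact: cvg_cst.
    by apply: cvg_expr; rewrite ger0_norm.
  by move=> /cvgr_le /(_ _ e0)[N _ /(_ N (leqnn N))]; exists N.
have [|l lP] := @l2_complete u.
  move=> e e0; have [N NP] := small _ e0; exists N => n m Nn Nm.
  wlog nm : n m Nn Nm / (n <= m)%N.
    by move=> W; have [|/ltnW] := leqP n m; [|rewrite nrmC]; exact: W.
  rewrite nrmC (le_trans (tail' _ _ nm))// (le_trans _ NP)//.
  rewrite ler_wpM2l ?mulr_ge0 ?invr_ge0 ?subr_ge0 ?(ltW r1)//.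
  by rewrite ler_wiXn2l// ltW.
exists l.
have fixl : Phi l = l.
  have /eqP : nrm (Phi l - l) = 0.
    apply/eqP; rewrite eq_le nrm_ge0 andbT; apply/ler_addgt0Pr => e e0.
    rewrite add0r; have [N NP] := lP _ (divr_gt0 e0 (ltr0Sn _ 1)).
    rewrite -(subrK (u N.+1) (Phi l)) -addrA (le_trans (nrmD _ _))//.
    rewrite [leRHS]splitr; apply: lerD; last by apply: NP; exact: leqnSn.
    apply: (le_trans (contr l (u N))); rewrite nrmC.
    apply: le_trans (NP N (leqnn N)).
    by rewrite ler_piMl ?nrm_ge0// ltW.
  rewrite sqrtr_eq0 => h.
  by apply/eqP; rewrite -subr_eq0; apply: contraTT h => /nsq_gt0; rewrite ltNge.
by rewrite -{1}fixl TG addrK.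
Qed.

End Completeness.

(** * Spectrum of a unitary operator *)

Section Resolvent.
Variables (R : realType) (I : choiceType).
Implicit Types (x y : l2 R I) (z : R[i]).

Lemma nrmZ z x : nrm (z *: x) = normc z * nrm x.
Proof.
by rewrite /nrm nsqZ sqrtrM ?sqr_ge0// sqrtr_sqr ger0_norm ?normc_ge0.
Qed.

Lemma nrmN x : nrm (- x) = nrm x.
Proof. by rewrite /nrm nsqN. Qed.

Lemma nrmB x y : nrm x - nrm y <= nrm (x - y).
Proof. by rewrite lerBlDr -{1}(subrK y x) nrmD. Qed.

Lemma nrm0_eq0 x : nrm x = 0 -> x = 0.
Proof.
move=> x0; apply: contrapT => /eqP /nsq_gt0.
by rewrite -nrm_sqr x0 expr0n ltxx.
Qed.

Lemma bounded_below_resolvent (U : {linear l2 R I -> l2 R I}) z (c : R) :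
  0 < c -> (forall x, c * nrm x <= nrm (U x - z *: x)) ->
  (forall y, exists x, U x - z *: x = y) -> resolvent_set U z.
Proof.
move=> c0 Uc Usurj; have [S SK] := choice Usurj.
have Uinj x y : U x - z *: x = U y - z *: y -> x = y.
  move=> xy; apply/eqP; rewrite -subr_eq0; apply/eqP/nrm0_eq0/eqP.
  rewrite eq_le nrm_ge0 andbT -(ler_pM2l c0) mulr0 (le_trans (Uc _))//.
  have -> : U (x - y) - z *: (x - y) = (U x - z *: x) - (U y - z *: y).
    by rewrite linearB scalerBr opprD addrACA -opprD.
  by rewrite xy subrr /nrm nsq0 sqrtr0.
have linS : linear S.
  move=> a x y; apply: Uinj; rewrite SK linearP scalerDr opprD addrACA SK.
  by rewrite scalerA mulrC -scalerA -scalerBr SK.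
pose Sl : {linear l2 R I -> l2 R I} :=
  HB.pack S (GRing.isLinear.Build _ _ _ _ S linS).
exists Sl; split => // [|x]; last by apply: Uinj; rewrite SK.
apply: bounded_linear_continuous; apply/linear_boundedP.
exists (c^-1)%:C%C; split.
  by rewrite ger0_real// ler0c invr_ge0 ltW.
move=> r cr x; apply: (@le_trans _ _ ((c^-1)%:C%C * `|x|)); last first.
  by rewrite ler_wpM2r// ltW.
rewrite !l2_normE -rmorphM lecR -/(nrm _) -/(nrm _) -(ler_pM2l c0).
by rewrite mulVKf ?gt_eqF// (le_trans (Uc _))// SK.
Qed.

Lemma resolvent_bounded_below (U : {linear l2 R I -> l2 R I}) z :
  resolvent_set U z ->
  exists2 c : R, 0 < c & forall x, c * nrm x <= nrm (U x - z *: x).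
Proof.
move=> [S [Sc SK _]].
have /linear_boundedP := continuous_linear_bounded 0 (Sc 0).
move=> /pinfty_ex_gt0[M M0 SM].
have [m m0 Mm] : exists2 m : R, 0 < m & M = m%:C%C.
  by move: M0 {SM}; case: M => a b; rewrite ltcE /= => /andP[/eqP-> ?]; exists a.
exists m^-1; first by rewrite invr_gt0.
move=> x; have := SM (U x - z *: x).
rewrite SK Mm !l2_normE -rmorphM lecR -!/(nrm _) => xm.
by rewrite ler_pdivrMl.
Qed.

End Resolvent.

Section UnitarySpectrum.
Variables (R : realType) (I : choiceType) (U : {linear l2 R I -> l2 R I}).
Hypothesis Uiso : forall x, nsq (U x) = nsq x.
Hypothesis Usurj : forall y, exists x, U x = y.
Implicit Types (x y : l2 R I) (z : R[i]).

Let Unrm x : nrm (U x) = nrm x.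
Proof. by rewrite /nrm Uiso. Qed.

Lemma surjective_inside_circle z : normc z < 1 ->
  forall y, exists x, U x - z *: x = y.
Proof.
move=> z1; apply: (@surjective_perturbation _ _ U ( *:%R z) (normc z) 1) => //.
- exact: linearB.
- exact: scalerBr.
- by rewrite normc_ge0.
- by move=> x; rewrite mul1r Unrm.
- by move=> x; rewrite nrmZ.
Qed.

(** The range of [U - z] is compared with that of [U - zt], where
    [zt = (1 - d) z] lies inside the disc, where surjectivity is known. The
    perturbation has size [d], while [U - zt] is still bounded below by [2 d]
    when [3 d <= c]. *)
Lemma bounded_below_surjective z (c : R) : normc z = 1 -> 0 < c ->
  (forall x, c * nrm x <= nrm (U x - z *: x)) ->
  forall y, exists x, U x - z *: x = y.
Proof.
move=> z1 c0 Uc.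
pose d : R := Num.min c 1 / 3.
have m0 : 0 < Num.min c 1 by rewrite lt_min c0 ltr01.
have d0 : 0 < d by rewrite divr_gt0.
have dc : 3 * d <= c by rewrite /d mulrC divfK// ge_min lexx.
have d1 : d < 1.
  by rewrite ltr_pdivrMr// mul1r (@le_lt_trans _ _ 1)// ?ge_min ?lexx ?orbT// ltr1n.
pose zt := (1 - d)%:C%C * z.
have zt1 : normc zt < 1.
  by rewrite normcM z1 mulr1 normcC ger0_norm ?subr_ge0 ?(ltW d1)// gtrBl.
have zE : z - zt = d%:C%C * z.
  by rewrite /zt -{1}[z]mul1r -mulrBl; congr (_ * _); rewrite -rmorphB opprB addrC subrK.
have zx x : U x - z *: x = (U x - zt *: x) - (z - zt) *: x.
  by rewrite scalerBl opprB addrA subrK.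
have zn x : nrm ((z - zt) *: x) = d * nrm x.
  by rewrite nrmZ zE normcM z1 mulr1 normcC gtr0_norm.
have TB : {morph (fun x => U x - zt *: x) : x y / x - y}.
  by move=> a b; rewrite linearB scalerBr opprD addrACA -opprD.
have Tc x : (2 * d) * nrm x <= nrm (U x - zt *: x).
  have := nrmD (U x - zt *: x) (- ((z - zt) *: x)); rewrite nrmN zn -zx => h.
  have dcx : 3 * d * nrm x <= c * nrm x by rewrite ler_wpM2r ?nrm_ge0.
  rewrite -(lerD2r (d * nrm x)) (le_trans _ h)// (le_trans _ (Uc x))//.
  by rewrite (le_trans _ dcx)// le_eqVlt; apply/orP; left; apply/eqP; ring.
have Bd x : nrm ((z - zt) *: x) <= d * nrm x by rewrite zn.
have dd : 0 <= d < 2 * d by rewrite ltW//= ltr_pMl// ltr1n.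
move=> y; have [x xP] := surjective_perturbation TB (scalerBr (z - zt))
  (surjective_inside_circle zt1) dd Tc Bd y.
by exists x; rewrite zx.
Qed.

(** Off the circle, [U x] and [z *: x] have lengths in a fixed ratio other
    than one, which bounds [U - z] below. Outside the disc, surjectivity holds
    because [U] is a small perturbation of [- z]. *)
Lemma spectrum_unit_circle z : spectrum U z -> normc z = 1.
Proof.
move=> zU; apply: contrapT => z1; apply: zU.
apply: (@bounded_below_resolvent _ _ _ _ `|1 - normc z|).
- by rewrite normr_gt0 subr_eq0 eq_sym; apply/eqP.
- move=> x; have h1 := nrmB (U x) (z *: x).
  have h2 := nrmB (z *: x) (U x).
  rewrite -[nrm (_ *: _ - _)]nrmN opprB in h2.
  rewrite nrmZ Unrm in h1 h2.
  by have [h|h] := lerP (normc z) 1; rewrite mulrBl mul1r.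
- have [h|h] := ltP (normc z) 1; first exact: surjective_inside_circle.
  have {}h : 1 < normc z by rewrite lt_neqAle h andbT eq_sym; apply/eqP.
  have NB : {morph (fun x : l2 R I => - z *: x) : x y / x - y}.
    by move=> x y; rewrite scalerBr.
  have UB : {morph (fun x : l2 R I => - U x) : x y / x - y}.
    by move=> x y; rewrite linearB opprD.
  have Nsurj y : exists x, - z *: x = y.
    exists ((- z)^-1 *: y); rewrite scalerA divff ?scale1r// oppr_eq0.
    by apply: contraTN h => /eqP ->; rewrite normc0 -leNgt ler01.
  have Nc x : normc z * nrm x <= nrm (- z *: x) by rewrite nrmZ normcN.
  have Ub x : nrm (- U x) <= 1 * nrm x by rewrite nrmN Unrm mul1r.
  have h01 : (0 : R) <= 1 < normc z by rewrite ler01.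
  move=> y; have [x xP] := surjective_perturbation NB UB Nsurj h01 Nc Ub y.
  by exists x; rewrite -xP opprK addrC scaleNr.
Qed.

Lemma spectrum_approx_eigenvector z (e : R) : spectrum U z -> 0 < e ->
  exists x, nrm (U x - z *: x) < e * nrm x.
Proof.
move=> zU e0; apply: contrapT => nx; apply: (zU).
have Uc x : e * nrm x <= nrm (U x - z *: x).
  by rewrite leNgt; apply/negP => h; apply: nx; exists x.
apply: (bounded_below_resolvent e0 Uc).
exact: (bounded_below_surjective (spectrum_unit_circle zU) e0 Uc).
Qed.

Lemma nsqB x y : nsq (x - y) = nsq x + nsq y - 2 * ip x y.
Proof. by rewrite nsqD nsqN ipNr mulrN. Qed.

(** The form on the left is represented by [2 - z^-1 U - z U^-1], as
    [z^-1] is the conjugate of [z]. Applying [U] to both arguments removes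
    [U^-1]. *)
Lemma ip_shifted z x y : normc z = 1 ->
  ip (U x - z *: x) (U y - z *: y) =
  ip (U x + U x - z *: x - z^-1 *: U (U x)) (U y).
Proof.
move=> z1.
have z0 : z != 0.
  by apply/eqP => zE; move: z1; rewrite zE normc0 => /eqP; rewrite eq_sym oner_eq0.
have ipU := @ip_isometry R I U _ _ (linearD U) Uiso.
have ipz (w : R[i]) : normc w = 1 -> forall a b : l2 R I, ip (w *: a) (w *: b) = ip a b.
  move=> w1 a b; apply: ip_isometry; first exact: scalerDr.
  by move=> v; rewrite nsqZ w1 expr1n mul1r.
have zi1 : normc z^-1 = 1 by rewrite normcV z1 invr1.
rewrite !(ipDl, ipDr, ipNl, ipNr) (ipz z z1) !ipU.
have -> : ip (U x) (z *: y) = ip (z^-1 *: U (U x)) (U y).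
  rewrite -linearZ ipU -{2}[y](scale1r y) -(mulVf z0) -scalerA.
  by rewrite ipz// ipU.
ring.
Qed.

(** Let [mu] be the infimum of [nsq (U x - z x) / nsq x], so that the form [q]
    below is nonnegative, and let [H] represent [nsq (U x - z x)]. With
    [phi = (H - mu) x], the inequality [0 <= q (x - phi / 4)] reads
    [nsq phi <= 4 q x], and [q x / nsq x] can be made arbitrarily small. But
    [- z U (H - mu) = (U - z w1) (U - z w2)], where [w1 + w2 = 2 - mu] and
    [w1 w2 = 1]; both factors would be bounded below if [z w1] and [z w2],
    which are at distance [sqrt mu] from [z], were in the resolvent set. *)
Lemma spectrum_near_approx_eigenvector z x0 (r : R) :
  normc z = 1 -> x0 != 0 -> nrm (U x0 - z *: x0) <= r * nrm x0 ->
  exists2 w, spectrum U w & normc (z - w) <= r.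
Proof.
move=> z1 x00 x0r.
have z0 : z != 0.
  by apply/eqP => zE; move: z1; rewrite zE normc0 => /eqP; rewrite eq_sym oner_eq0.
have r0 : 0 <= r.
  have x0n : 0 < nrm x0 by rewrite sqrtr_gt0 nsq_gt0.
  by rewrite -(pmulr_lge0 _ x0n) (le_trans _ x0r)// nrm_ge0.
pose S : set R := [set nsq (U x - z *: x) / nsq x | x in [set x | x != 0]].
have S_lb : lbound S 0.
  by move=> _ [x _ <-]; rewrite divr_ge0 ?nsq_ge0.
have S_ne : S !=set0 by exists (nsq (U x0 - z *: x0) / nsq x0); exists x0.
have S_hi : has_inf S by split => //; exists 0.
pose mu := inf S.
have mu0 : 0 <= mu by exact: lb_le_inf.
have mule x : x != 0 -> mu <= nsq (U x - z *: x) / nsq x.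
  by move=> xN; apply: ge_inf; [exists 0|exists x].
have Uz4 x : nsq (U x - z *: x) <= 4 * nsq x.
  by have := nsqD_le (U x) (- (z *: x)); rewrite nsqN nsqZ z1 Uiso; lra.
have mur : mu <= r ^+ 2.
  apply: le_trans (mule _ x00) _; rewrite ler_pdivrMr ?nsq_gt0//.
  by rewrite -!nrm_sqr -exprMn lerXn2r ?nnegrE ?mulr_ge0 ?nrm_ge0.
have mu4 : mu <= 4.
  by apply: le_trans (mule _ x00) _; rewrite ler_pdivrMr ?nsq_gt0.
pose q x := nsq (U x - z *: x) - mu * nsq x.
have q0 x : 0 <= q x.
  have [->|xN] := eqVneq x 0; first by rewrite /q nsq0 mulr0 subr0 nsq_ge0.
  by rewrite subr_ge0 -ler_pdivlMr ?nsq_gt0// mule.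
pose a := 1 - mu / 2.
pose s := Num.sqrt (1 - a ^+ 2).
have a1 : 0 <= 1 - a ^+ 2 by rewrite /a; nra.
have s2 : s ^+ 2 = 1 - a ^+ 2 by rewrite sqr_sqrtr.
pose w1 : R[i] := (a +i* s)%C; pose w2 : R[i] := (a -i* s)%C.
have w12 : w1 * w2 = 1.
  apply/eqP; rewrite eq_complex /=; apply/andP; split; apply/eqP.
    by rewrite mulrN opprK -!expr2 s2 addrC subrK.
  by rewrite mulrN mulrC addrC subrr.
have w1D2 : w1 + w2 = (2 - mu)%:C%C.
  by apply/eqP; rewrite eq_complex /= /a; apply/andP; split; apply/eqP; field.
have near (t : R) : t ^+ 2 = 1 - a ^+ 2 -> normc (z - z * (a +i* t)%C) <= r.
  move=> t2; rewrite -{1}[z]mulr1 -mulrBr normcM z1 mul1r.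
  rewrite -(ler_pXn2r (n := 2)) ?nnegrE ?normc_ge0// normc_sqr /=.
  by rewrite sub0r sqrrN t2 (le_trans _ mur)// /a; lra.
apply: contrapT => noW.
have res (t : R) : t ^+ 2 = 1 - a ^+ 2 -> resolvent_set U (z * (a +i* t)%C).
  by move=> /near h; apply: contrapT => hw; apply: noW; exists (z * (a +i* t)%C).
have [c1 c10 U1] := resolvent_bounded_below (res s s2).
have [c2 c20 U2] : exists2 c : R, 0 < c &
    forall x, c * nrm x <= nrm (U x - (z * w2) *: x).
  by apply: resolvent_bounded_below; apply: res; rewrite sqrrN.
pose e := (c1 * c2) ^+ 2 / 4.
have e0 : 0 < e by rewrite divr_gt0// exprn_gt0// mulr_gt0.
have [_ [x xN <-]] := inf_adherent e0 S_hi.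
rewrite -/mu ltr_pdivrMr ?nsq_gt0// => xe.
have qx : q x < e * nsq x by rewrite /q ltrBlDl -mulrDl.
pose y1 := U x - (z * w2) *: x.
pose y := U y1 - (z * w1) *: y1.
have yc : c1 * c2 * nrm x <= nrm y.
  by rewrite (le_trans _ (U1 y1))// -mulrA ler_pM2l// U2.
have [phi phiE] := Usurj (- (z^-1 *: y)).
have nphi : nsq phi = nsq y.
  by rewrite -Uiso phiE nsqN nsqZ normcV z1 invr1 expr1n mul1r.
have yE : U x + U x - z *: x - z^-1 *: U (U x) - mu%:C%C *: U x = - (z^-1 *: y).
  have alg (p t v : R[i]) : p + p - z * t - z^-1 * v - mu%:C%C * p =
      - (z^-1 * (v - z * w2 * p - z * w1 * (p - z * w2 * t))).
    transitivity (- z^-1 * v + (w1 + w2) * (z^-1 * z) * p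
                  - w1 * w2 * (z^-1 * z) * z * t); last by ring.
    by rewrite mulVf// w12 w1D2 rmorphB /=; ring.
  have Uy1 : U y1 = U (U x) - (z * w2) *: U x by rewrite linearB linearZ.
  rewrite /y Uy1 /y1; apply: val_inj; apply/funext => i; exact: alg.
(* The quarter makes the quadratic term, at most [4 * nsq psi], half of the
   linear one. *)
pose psi := (4^-1)%:C%C *: phi.
have ippsi : ip (U x - z *: x) (U psi - z *: psi) - mu * ip x psi = nsq phi / 4.
  rewrite ip_shifted// -(ip_isometry x psi (linearD U) Uiso).
  rewrite -ipZl// -ipNl -ipDl yE -phiE linearZ /= ipC ipZl ?invr_ge0//.
  by rewrite ipff Uiso mulrC.
have psi2 : nsq psi = nsq phi / 16.
  by rewrite nsqZ normcC ger0_norm ?invr_ge0//; field.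
have := q0 (x - psi); rewrite /q.
have -> : U (x - psi) - z *: (x - psi) = (U x - z *: x) - (U psi - z *: psi).
  by rewrite linearB scalerBr opprD addrACA -opprD.
rewrite (nsqB (U x - z *: x)) (nsqB x) => q1.
have y2 : (c1 * c2) ^+ 2 * nsq x <= nsq y.
  rewrite -!nrm_sqr -exprMn lerXn2r ?nnegrE ?nrm_ge0//.
  by rewrite !mulr_ge0 ?nrm_ge0// ltW.
have := Uz4 psi; rewrite psi2 in q1 *.
move: qx y2 q1 ippsi; rewrite /q /e nphi.
have := mulr_ge0 mu0 (nsq_ge0 y).
set A := nsq (U x - z *: x); set B := nsq (U psi - z *: psi).
set C := ip _ (U psi - _); set D := ip x psi.
lra.
Qed.

End UnitarySpectrum.

(** * The walk as a product of two unitaries *)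

Section Esum.
Variables (R : realType) (I : choiceType).
Local Open Scope ereal_scope.

Lemma esumZ (r : R) (F : I -> \bar R) : (0 <= r)%R -> (forall i, 0 <= F i) ->
  \esum_(i in [set: I]) (r%:E * F i) = r%:E * \esum_(i in [set: I]) F i.
Proof.
have le (s : R) (G : I -> \bar R) : (0 <= s)%R -> (forall i, 0 <= G i) ->
    \esum_(i in [set: I]) (s%:E * G i) <= s%:E * \esum_(i in [set: I]) G i.
  move=> s0 G0; apply: ge_ereal_sup => _ [X [finX _] <-].
  rewrite -ge0_mule_fsumr//; apply: lee_wpmul2l; first by rewrite lee_fin.
  by apply: esum_ge; exists X.
move=> r0 F0; apply/eqP; rewrite eq_le le//=.
have [->|rN] := eqVneq r 0%R.
  by rewrite mul0e esum_ge0// => i _; rewrite mul0e.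
have rp : (0 < r)%R by rewrite lt_neqAle eq_sym rN.
have := le r^-1%R (fun i => r%:E * F i).
rewrite invr_ge0 r0 => /(_ isT (fun i => mule_ge0 _ (F0 i))).
have -> : \esum_(i in [set: I]) ((r^-1)%:E * (r%:E * F i)) = \esum_(i in [set: I]) F i.
  by apply: eq_esum => i _; rewrite muleA -EFinM mulVf// mul1e.
by move=> h; rewrite -lee_pdivlMl//; apply: h; rewrite lee_fin.
Qed.

(** Summed over all [i], each of the two sides counts its own sum twice. *)
Lemma esum_pairing (e : I -> I) (F G : I -> R) : bijective e ->
  (forall i, 0 <= F i)%R -> (forall i, 0 <= G i)%R ->
  (forall i, F i + F (e i) <= G i + G (e i))%R ->
  \esum_(i in [set: I]) (F i)%:E <= \esum_(i in [set: I]) (G i)%:E.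
Proof.
move=> be F0 G0 FG.
have dbl (H : I -> R) : (forall i, 0 <= H i)%R ->
    \esum_(i in [set: I]) (H i + H (e i))%:E = 2%:E * \esum_(i in [set: I]) (H i)%:E.
  move=> H0.
  have -> : \esum_(i in [set: I]) (H i + H (e i))%:E =
      \esum_(i in [set: I]) (H i)%:E + \esum_(i in [set: I]) (H (e i))%:E.
    by rewrite -esumD; [|move=> i _; rewrite lee_fin..].
  rewrite -(@reindex_esum R I I setT setT e (fun i => (H i)%:E)) ?setTT_bijective//.
  by rewrite -[2%R]/(1 + 1)%R EFinD ge0_muleDl ?mul1e.
rewrite -(@lee_pmul2l _ 2%:E)// -!dbl//.
by apply: le_esum => i _; rewrite lee_fin.
Qed.

End Esum.

Section WalkFactors.
Variable R : realType.
Local Open Scope complex_scope.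
Local Notation site := (int * bool)%type.
Implicit Types (f g : site -> R[i]) (phi : int -> R).

(** At each site the coin is a matrix of SU(2), of determinant
    [l^2 cos^2 + l^2 sin^2 + (1 - l^2)]. *)
Definition coin (l : R) phi f : site -> R[i] := fun '(n, b) =>
  if b then (l * cos (phi n) +i* colambda l) * f (n, true)
            - (l * sin (phi n))%:C * f (n, false)
  else (l * sin (phi n))%:C * f (n, true)
            + (l * cos (phi n) -i* colambda l) * f (n, false).

Definition gshift (l : R) g : site -> R[i] := fun '(n, b) =>
  if b then l%:C * g (n - 1, true) - (colambda l)%:C * g (n, false)
  else l%:C * g (n + 1, false) + (colambda l)%:C * g (n, true).

Definition phase (alpha theta : R) (n : int) : R :=
  2 * pi * (n%:~R * alpha + theta).

Lemma uamo_fun_factor l1 l2 alpha theta f :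
  uamo_fun l1 l2 alpha theta f = gshift l1 (coin l2 (phase alpha theta) f).
Proof. by apply/funext => -[n []]. Qed.

Lemma colambda_sqr (l : R) : 0 <= l <= 1 -> colambda l ^+ 2 = 1 - l ^+ 2.
Proof. by move=> /andP[l0 l1]; rewrite sqr_sqrtr// subr_ge0 expr_le1. Qed.

Definition flip (i : site) : site := (i.1, ~~ i.2).

Lemma flip_bij : bijective flip.
Proof. by exists flip => -[n b]; rewrite /flip /= negbK. Qed.

(** The site at which [gshift] collects the amplitude of site [i] with weight
    [l]. *)
Definition hop (i : site) : site := (if i.2 then i.1 + 1 else i.1 - 1, i.2).

Lemma hop_bij : bijective hop.
Proof.
exists (fun i => (if i.2 then i.1 - 1 else i.1 + 1, i.2)).
  by move=> [n []]; rewrite /hop /= ?addrK ?subrK.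
by move=> [n []]; rewrite /hop /= ?addrK ?subrK.
Qed.

Lemma sqnorm_hop f : sqnorm f = sqnorm (fun i => f (hop i)).
Proof.
rewrite /sqnorm.
by rewrite (@reindex_esum R _ _ setT setT hop (fun i => (normc (f i) ^+ 2)%:E))
  ?setTT_bijective//; exact: hop_bij.
Qed.

Lemma sqnorm_pairing (e : site -> site) f g : bijective e ->
  (forall i, normc (f i) ^+ 2 + normc (f (e i)) ^+ 2 =
             normc (g i) ^+ 2 + normc (g (e i)) ^+ 2) -> sqnorm f = sqnorm g.
Proof.
move=> be fg; apply/eqP; rewrite eq_le; apply/andP; split;
  apply: (esum_pairing be) => i; rewrite ?sqr_ge0// fg//.
Qed.

Lemma sqnorm_coin l phi f : 0 <= l <= 1 -> sqnorm (coin l phi f) = sqnorm f.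
Proof.
move=> l01; apply: (sqnorm_pairing flip_bij) => -[n b].
have := colambda_sqr l01; have := cos2Dsin2 (phi n).
wlog -> : b / b = true.
  move=> W cs co; have [->|->] : b = true \/ b = false by case: b; [left|right].
    exact: W.
  by have := W true erefl cs co; rewrite /flip /= addrC [in RHS]addrC.
rewrite /flip /coin /= !normc_sqr.
set c := cos _; set s := sin _; set k := colambda l => cs co.
case: (f (n, true)) => a1 a2; case: (f (n, false)) => b1 b2 /=.
transitivity ((k ^+ 2 + l ^+ 2 * (c ^+ 2 + s ^+ 2)) *
  (a1 ^+ 2 + a2 ^+ 2 + (b1 ^+ 2 + b2 ^+ 2))); first by ring.
by rewrite cs co mulr1 subrK mul1r.
Qed.

(** Read at the target of each hop, [gshift] rotates every pair formed by [+] at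
    [n] and [-] at [n + 1]. *)
Lemma sqnorm_gshift l g : 0 <= l <= 1 -> sqnorm (gshift l g) = sqnorm g.
Proof.
move=> l01; rewrite sqnorm_hop.
pose e (i : site) : site := (if i.2 then i.1 + 1 else i.1 - 1, ~~ i.2).
have be : bijective e.
  by exists e => -[n []]; rewrite /e /= ?addrK ?subrK.
apply: (sqnorm_pairing be) => -[n b].
have := colambda_sqr l01.
wlog -> : n b / b = true.
  move=> W co; have [->|->] : b = true \/ b = false by case: b; [left|right].
    exact: W.
  have := W (n - 1) true erefl co.
  by rewrite /e /hop /gshift /= !subrK => Wn; rewrite addrC Wn addrC.
rewrite /e /hop /gshift /= !addrK !normc_sqr; set k := colambda l => co.
case: (g (n, true)) => a1 a2; case: (g (n + 1, false)) => b1 b2 /=.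
transitivity ((k ^+ 2 + l ^+ 2) *
  (a1 ^+ 2 + a2 ^+ 2 + (b1 ^+ 2 + b2 ^+ 2))); first by ring.
by rewrite co subrK mul1r.
Qed.

Lemma sqnorm_uamo_fun l1 l2 alpha theta f : 0 <= l1 <= 1 -> 0 <= l2 <= 1 ->
  sqnorm (uamo_fun l1 l2 alpha theta f) = sqnorm f.
Proof. by move=> h1 h2; rewrite uamo_fun_factor sqnorm_gshift// sqnorm_coin. Qed.

Definition coin_inv (l : R) phi f : site -> R[i] := fun '(n, b) =>
  if b then (l * cos (phi n) -i* colambda l) * f (n, true)
            + (l * sin (phi n))%:C * f (n, false)
  else - (l * sin (phi n))%:C * f (n, true)
            + (l * cos (phi n) +i* colambda l) * f (n, false).

Definition gshift_inv (l : R) g : site -> R[i] := fun '(n, b) =>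
  if b then l%:C * g (n + 1, true) + (colambda l)%:C * g (n, false)
  else l%:C * g (n - 1, false) - (colambda l)%:C * g (n, true).

Lemma coin_invK l phi : 0 <= l <= 1 -> cancel (coin_inv l phi) (coin l phi).
Proof.
move=> l01 f; apply/funext => i.
have := colambda_sqr l01; have := cos2Dsin2 (phi i.1).
set c := cos (phi i.1); set s := sin (phi i.1); set k := colambda l => cs co.
pose A : R[i] := l * c +i* k; pose B : R[i] := l * c -i* k.
pose S : R[i] := (l * s)%:C.
have one : A * B + S * S = 1.
  apply/eqP; rewrite eq_complex /=; apply/andP; split; apply/eqP; last by ring.
  transitivity (k ^+ 2 + l ^+ 2 * (c ^+ 2 + s ^+ 2)); first by ring.
  by rewrite cs co mulr1 subrK.
have alg1 (p q : R[i]) : A * (B * p + S * q) - S * (- S * p + A * q) = p.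
  by transitivity ((A * B + S * S) * p); [ring|rewrite one mul1r].
have alg2 (p q : R[i]) : S * (B * p + S * q) + B * (- S * p + A * q) = q.
  by transitivity ((A * B + S * S) * q); [ring|rewrite one mul1r].
by case: i @c @s cs @A @B @S one alg1 alg2 => n [] c s cs A B S one alg1 alg2;
  [exact: alg1|exact: alg2].
Qed.

Lemma gshift_invK l : 0 <= l <= 1 -> cancel (gshift_inv l) (gshift l).
Proof.
move=> l01 g; apply/funext => -[n b].
have co := colambda_sqr l01.
have one : l%:C * l%:C + (colambda l)%:C * (colambda l)%:C = 1.
  by rewrite -!rmorphM -rmorphD -!expr2 /= co addrC subrK.
rewrite /gshift /gshift_inv subrK addrK.
case: b.
  transitivity ((l%:C * l%:C + (colambda l)%:C * (colambda l)%:C) * g (n, true)).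
    by ring.
  by rewrite one mul1r.
transitivity ((l%:C * l%:C + (colambda l)%:C * (colambda l)%:C) * g (n, false)).
  by ring.
by rewrite one mul1r.
Qed.

End WalkFactors.

Lemma uamo_fun_linear (R : realType) (lambda1 lambda2 alpha theta : R)
    (a : R[i]) (f g : int * bool -> R[i]) :
  uamo_fun lambda1 lambda2 alpha theta (fun i => a * f i + g i) =
  (fun i => a * uamo_fun lambda1 lambda2 alpha theta f i
            + uamo_fun lambda1 lambda2 alpha theta g i).
Proof. by apply/funext => -[n []]; rewrite /uamo_fun; ring. Qed.

Lemma uamo_linear (R : realType) (lambda1 lambda2 alpha theta : R) :
  linear (uamo lambda1 lambda2 alpha theta).
Proof.
by move=> a f g; apply: val_inj; exact: (uamo_fun_linear _ _ _ _ a f g).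
Qed.

HB.instance Definition _ (R : realType) (lambda1 lambda2 alpha theta : R) :=
  GRing.isLinear.Build _ _ _ _ (uamo lambda1 lambda2 alpha theta)
    (@uamo_linear R lambda1 lambda2 alpha theta).

Section UamoUnitary.
Variables (R : realType) (lambda1 lambda2 : R).
Hypotheses (l1P : 0 <= lambda1 <= 1) (l2P : 0 <= lambda2 <= 1).
Implicit Types (alpha theta : R).
Local Notation W := (uamo lambda1 lambda2).

Lemma nsq_uamo alpha theta f : nsq (W alpha theta f) = nsq f.
Proof. by apply: EFin_inj; rewrite !nsqE; exact: sqnorm_uamo_fun. Qed.

(** The formal inverse of [W] is applied to [g]; its value is square summable
    because [sqnorm_uamo_fun] holds for arbitrary functions. *)
Lemma uamo_surjective alpha theta g : exists f, W alpha theta f = g.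
Proof.
pose f := coin_inv lambda2 (phase alpha theta) (gshift_inv lambda1 g).
have fg : uamo_fun lambda1 lambda2 alpha theta f = g.
  by rewrite uamo_fun_factor coin_invK// gshift_invK.
have fS : f \in square_summable (R := R) (I := (int * bool)%type).
  apply/square_summableP; rewrite -(sqnorm_uamo_fun alpha theta _ l1P l2P) fg.
  by apply/square_summableP; exact: valP.
by exists (L2 fS); apply: val_inj.
Qed.

End UamoUnitary.

(** * Localized approximate eigenvectors *)

Section Cutoff.
Variable R : realType.
Local Open Scope complex_scope.
Local Notation site := (int * bool)%type.
Implicit Types (f g : site -> R[i]).

Definition weight (w : int -> R) (m : int) f : site -> R[i] :=
  fun i => (w (i.1 - m))%:C * f i.

(** Averaging over the centre [m]: after exchanging the two sums, every site
    receives the same total weight [E]. *)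
Lemma esum_sqnorm_weight (w : int -> R) (E : R) f :
  (\esum_(j in [set: int]) (w j ^+ 2)%:E)%E = E%:E ->
  (\esum_(m in [set: int]) sqnorm (weight w m f))%E = (E%:E * sqnorm f)%E.
Proof.
move=> wE; rewrite /sqnorm.
have E0 : 0 <= E by rewrite -lee_fin -wE esum_ge0// => j _; rewrite lee_fin sqr_ge0.
rewrite esum_esum; last by move=> m i _ _; rewrite lee_fin sqr_ge0.
rewrite -esumZ//; last by move=> i; rewrite lee_fin sqr_ge0.
pose sw (k : site * int) : int * site := (k.2, k.1).
rewrite (@reindex_esum R _ _ ([set: site] `*`` (fun=> [set: int])) _ sw); last first.
  by split=> [//|[a b] [c d] _ _ [-> ->]//|[a b] _]; exists (b, a).
rewrite -(esum_esum (a := fun i m => (normc (weight w m f i) ^+ 2)%:E)); last first.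
  by move=> *; rewrite lee_fin sqr_ge0.
apply: eq_esum => i _.
have -> : (E%:E * (normc (f i) ^+ 2)%:E)%E =
    (\esum_(m in [set: int]) ((normc (f i) ^+ 2)%:E * (w (i.1 - m) ^+ 2)%:E))%E.
  rewrite esumZ ?sqr_ge0//; last by move=> m; rewrite lee_fin sqr_ge0.
  rewrite muleC -wE; congr (_ * _)%E.
  rewrite (@reindex_esum R _ _ setT setT (fun m => i.1 - m))//.
  rewrite setTT_bijective; exists (fun m => i.1 - m) => m; by rewrite subKr.
apply: eq_esum => m _.
by rewrite /weight normcM normcC exprMn real_normK ?num_real// mulrC EFinM.
Qed.

(** The truncated subtraction makes this [L - `|j|] on the window and zero
    outside; leaving the height [L] unnormalized keeps all slopes at most one. *)
Definition tent (L : nat) (j : int) : R := (L - `|j|)%N%:R.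
Definition box (L : nat) (j : int) : R := (`|j| <= L)%N%:R.

Lemma esum_centered (L : nat) (F : int -> R) :
  (forall j, 0 <= F j) -> (forall j : int, (L < `|j|)%N -> F j = 0) ->
  (\esum_(j in [set: int]) (F j)%:E)%E =
  (\sum_(k < L.+1 + L) F (k%:Z - L%:Z))%:E.
Proof.
move=> F0 Fs.
have -> : (\esum_(j in [set: int]) (F j)%:E =
    \esum_(j in [set j : int | (`|j| <= L)%N]) (F j)%:E)%E.
  rewrite [RHS]esum_mkcond; apply: eq_esum => j _; case: ifPn => //.
  by rewrite notin_setE /= => /negP; rewrite -ltnNge => /Fs ->.
rewrite (@reindex_esum R _ _ `I_(L.+1 + L) _ (fun k : nat => k%:Z - L%:Z)); last first.
  split.
  - by move=> k /=; lia.
  - by move=> a b _ _ /addIr [].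
  - move=> j /= jL; exists `|(j + L%:Z)%R|%N => /=; lia.
rewrite esum_fset//; last by move=> k _; rewrite lee_fin.
by rewrite -fsbig_ord sumEFin.
Qed.

Lemma esum_box (L : nat) :
  (\esum_(j in [set: int]) (box L j ^+ 2)%:E)%E = (2 * L%:R + 1)%:E.
Proof.
rewrite (@esum_centered L).
- congr EFin; rewrite (eq_bigr (fun=> 1)).
    rewrite sumr_const card_ord (_ : (L.+1 + L)%N = (2 * L + 1)%N); last by lia.
    by rewrite natrD natrM.
  by move=> k _; rewrite /box (_ : (_ <= _)%N = true) ?expr1n//; case: k => k /=; lia.
- by move=> j; rewrite sqr_ge0.
- by move=> j; rewrite ltnNge /box => /negbTE ->; rewrite expr0n.
Qed.

(** The mass [E] of the squared tent is of order [L^3], against order [L] for the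
    squared slopes ([esum_box]); for a sharp cut-off the corresponding ratio
    would be [L^-1] instead of [L^-2]. *)
Lemma esum_tent (L : nat) : exists2 E : R,
  (\esum_(j in [set: int]) (tent L j ^+ 2)%:E)%E = E%:E & L%:R ^+ 3 <= 3 * E.
Proof.
exists (\sum_(k < L.+1 + L) tent L (k%:Z - L%:Z) ^+ 2).
  apply: (@esum_centered L (fun j => tent L j ^+ 2)) => j; first exact: sqr_ge0.
  by move=> /ltnW; rewrite /tent -subn_eq0 => /eqP ->; rewrite expr0n.
rewrite big_split_ord /= mulrDr.
apply: ler_wpDr; first by rewrite mulr_ge0// sumr_ge0// => k _; exact: sqr_ge0.
rewrite (eq_bigr (fun k : 'I_L.+1 => (k%:R : R) ^+ 2)); last first.
  by move=> k _; rewrite /tent; congr (_%:R ^+ 2); case: k => k /=; lia.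
elim: L => [|L IH]; first by rewrite expr0n mulr_ge0// sumr_ge0// => k _; exact: sqr_ge0.
rewrite big_ord_recr /= mulrDr.
apply: le_trans (lerD IH (lexx _)).
have := ler0n R L; rewrite -natr1; move: (L%:R) => x x0; nra.
Qed.

Lemma tent_shift_le (L : nat) (j k : int) : (`|(j - k)%R| <= 1)%N ->
  `|tent L k - tent L j| <= box L j.
Proof.
move=> jk; rewrite /tent /box; case: (leqP `|j| L) => jL /=.
  have kj : (L - `|k| <= (L - `|j|).+1)%N by lia.
  have kj' : (L - `|j| <= (L - `|k|).+1)%N by lia.
  rewrite -(ler_nat R) -natr1 in kj; rewrite -(ler_nat R) -natr1 in kj'.
  rewrite ler_norml; lra.
have -> : (L - `|k| = 0)%N by lia.
have -> : (L - `|j| = 0)%N by lia.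
rewrite subrr normr0; exact: lexx.
Qed.

Lemma coin_weight l phi (w : int -> R) m f :
  coin l phi (weight w m f) = weight w m (coin l phi f).
Proof. by apply/funext => -[n []]; rewrite /coin /weight /=; ring. Qed.

(** [[gshift, w] g]: the coin is diagonal in the position, so only the hopping
    part of [gshift] sees the variation of the weight. *)
Definition commutator l (w : int -> R) m g : site -> R[i] := fun '(n, b) =>
  let k := if b then n - 1 else n + 1 in
  (l * (w (k - m) - w (n - m)))%:C * g (k, b).

Lemma gshift_weight l (w : int -> R) m g i :
  gshift l (weight w m g) i = weight w m (gshift l g) i + commutator l w m g i.
Proof.
by case: i => n []; rewrite /gshift /weight /commutator /= rmorphM rmorphB /=; ring.
Qed.

Lemma sqnorm_commutator l (L : nat) m g : 0 <= l <= 1 ->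
  (sqnorm (commutator l (tent L) m g) <= sqnorm (weight (box L) m g))%E.
Proof.
move=> /andP[l0 l1]; rewrite sqnorm_hop; apply: le_esum => -[n b] _.
rewrite lee_fin ler_pXn2r ?nnegrE ?normc_ge0//.
have -> : commutator l (tent L) m g (hop (n, b)) =
    (l * (tent L (n - m) - tent L ((hop (n, b)).1 - m)))%:C * g (n, b).
  by case: b; rewrite /hop /commutator /= ?addrK ?subrK.
rewrite /weight !normcM !normcC ler_wpM2r ?normc_ge0//.
rewrite normrM ger0_norm// -[leRHS]mul1r ler_pM//.
rewrite distrC [leRHS]ger0_norm ?ler0n//; apply: tent_shift_le.
by case: b; rewrite /hop /=; lia.
Qed.

End Cutoff.

Section Localization.
Variables (R : realType) (lambda1 lambda2 : R).
Hypotheses (l1P : 0 <= lambda1 <= 1) (l2P : 0 <= lambda2 <= 1).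
Local Open Scope complex_scope.
Local Notation site := (int * bool)%type.

(** If every centre [m] failed, summing the failures over [m] would give
    [20 / L^2 * E * nsq psi <= 2 E nsq chi + 2 (2 L + 1) nsq psi], where [chi] is
    the error of the uncut vector [psi]. This contradicts
    [L^2 nsq chi < nsq psi] and [L^3 <= 3 E]. *)
Lemma localized_approx_eigenvector (alpha theta : R) (z : R[i]) (L : nat) :
  (0 < L)%N -> spectrum (uamo lambda1 lambda2 alpha theta) z ->
  exists (m : int) (f : l2 R site),
    (forall n b, (L <= `|(n - m)%R|)%N -> f (n, b) = 0) /\
    nsq (uamo lambda1 lambda2 alpha theta f - z *: f) < 20 / L%:R ^+ 2 * nsq f.
Proof.
move=> L0 zW; set W := uamo _ _ _ _.
have x0 : 0 < L%:R :> R by rewrite ltr0n.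
have x1 : 1 <= L%:R :> R by rewrite ler1n.
have [psi psiz] : exists x : l2 R site, nrm (W x - z *: x) < L%:R^-1 * nrm x.
  apply: (@spectrum_approx_eigenvector R _ W) => //; last by rewrite invr_gt0.
    by move=> x; exact: nsq_uamo.
  by move=> y; exact: uamo_surjective.
pose chi := W psi - z *: psi.
pose g := coin lambda2 (phase alpha theta) psi.
have tent_le m (i : site) : normc (tent R L (i.1 - m))%:C <= L%:R.
  by rewrite normcC ger0_norm ?ler0n// ler_nat leq_subr.
have fS m : weight (tent R L) m psi \in square_summable (R := R) (I := site).
  by apply: (square_summableM (tent_le m)); exact: valP.
pose f m := L2 (fS m).
have split_f m : sqnorm (W (f m) - z *: f m) =
    sqnorm (fun i => weight (tent R L) m chi i
                     + commutator lambda1 (tent R L) m g i)%R.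
  congr sqnorm; apply/funext => i.
  rewrite [LHS]/(uamo_fun lambda1 lambda2 alpha theta (weight (tent R L) m psi) i
    - z * weight (tent R L) m psi i).
  have chiE : chi i = gshift lambda1 g i - z * psi i.
    by rewrite /g -uamo_fun_factor.
  have alg (w p c q : R[i]) : w * p + c - z * (w * q) = w * (p - z * q) + c.
    by ring.
  by rewrite uamo_fun_factor coin_weight gshift_weight -/g /weight chiE; exact: alg.
have [E EE LE] := esum_tent R L.
have N0 : 0 < nrm psi.
  by rewrite -(pmulr_rgt0 _ (_ : 0 < L%:R^-1)) ?invr_gt0// (le_lt_trans _ psiz)// nrm_ge0.
have {}psiz : L%:R ^+ 2 * nsq chi < nsq psi.
  rewrite -!nrm_sqr -exprMn ltr_pXn2r ?nnegrE ?mulr_ge0 ?nrm_ge0 ?ler0n//.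
  by rewrite -ltr_pdivlMl.
have {}N0 : 0 < nsq psi by rewrite -nrm_sqr exprn_gt0.
apply: contrapT => nf.
have {}nf m : 20 / L%:R ^+ 2 * nsq (f m) <= nsq (W (f m) - z *: f m).
  rewrite leNgt; apply/negP => h; apply: nf; exists m, (f m); split=> // n b Ln.
  rewrite [LHS]/((tent R L (n - m))%:C * psi (n, b)).
  by move: Ln; rewrite /tent -subn_eq0 => /eqP ->; exact: mul0r.
have bound m : ((20 / L%:R ^+ 2)%:E * sqnorm (weight (tent R L) m psi) <=
    2%:E * sqnorm (weight (tent R L) m chi) + 2%:E * sqnorm (weight (box R L) m g))%E.
  have := nf m; rewrite -lee_fin EFinM !nsqE split_f => /le_trans; apply.
  apply: (le_trans (sqnormD_le _ _ ltr01)); rewrite invr1; apply: leeD => //.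
  by apply: lee_wpmul2l; rewrite ?lee_fin// sqnorm_commutator.
have k0 : 0 <= 20 / L%:R ^+ 2 :> R by rewrite divr_ge0// sqr_ge0.
have := le_esum (I := [set: int]) (fun m _ => bound m).
rewrite esumD; try by move=> m _; rewrite mule_ge0 ?sqnorm_ge0// lee_fin.
rewrite !esumZ//; try by move=> m; exact: sqnorm_ge0.
rewrite (esum_sqnorm_weight _ EE) (esum_sqnorm_weight _ EE).
rewrite (esum_sqnorm_weight _ (esum_box R L)) sqnorm_coin//.
rewrite -!nsqE -!EFinM -EFinD lee_fin.
apply/negP; rewrite -ltNge.
move: x0 x1 LE psiz N0; move: (L%:R) (nsq psi) (nsq chi) => x N M x0 x1 LE MN N0.
have E0 : 0 < E.
  by rewrite -(pmulr_rgt0 _ (_ : 0 < 3)) ?(lt_le_trans _ LE)// exprn_gt0.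
rewrite -(ltr_pM2l (exprn_gt0 2 x0)).
have -> : x ^+ 2 * (20 / x ^+ 2 * (E * N)) = 20 * E * N.
  by field; rewrite gt_eqF.
have EM : E * (x ^+ 2 * M) < E * N by rewrite ltr_pM2l.
have xN : x ^+ 3 * N <= 3 * E * N by rewrite ler_pM2r.
have x2N : x ^+ 2 * N <= x ^+ 3 * N.
  by rewrite ler_pM2r// ler_weXn2l.
rewrite !mulrDr; lra.
Qed.

End Localization.

(** * Moving approximate eigenvectors between parameters *)

Section Chord.
Variable R : realType.
Implicit Types (x y a b : R).

Lemma sin_sqr_le x : sin x ^+ 2 <= x ^+ 2.
Proof.
wlog x0 : x / 0 <= x.
  move=> H; have [/H//|/ltW] := leP 0 x.
  by rewrite -oppr_ge0 => /H; rewrite sinN !sqrrN.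
have [c _] := @MVT_segment R sin cos 0 x x0
  (fun y _ => is_derive_sin y)
  (continuous_subspaceT (@continuous_sin R)).
rewrite sin0 !subr0 => ->; rewrite exprMn ler_piMl ?sqr_ge0//.
Qed.

Lemma chord_sqr_le x y :
  (cos x - cos y) ^+ 2 + (sin x - sin y) ^+ 2 <= (x - y) ^+ 2.
Proof.
have -> : (cos x - cos y) ^+ 2 + (sin x - sin y) ^+ 2 = 4 * sin ((x - y) / 2) ^+ 2.
  have h : cos (x - y) = 1 - 2 * sin ((x - y) / 2) ^+ 2.
    rewrite {1}(_ : x - y = (x - y) / 2 *+ 2); last by rewrite -mulr_natr divfK.
    by rewrite cos_mulr2n cos2sin2; ring.
  have := cos2Dsin2 x; have := cos2Dsin2 y; have := cosB x y; rewrite h.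
  move: (cos x) (cos y) (sin x) (sin y) => cx cy sx sy; nra.
have := sin_sqr_le ((x - y) / 2); rewrite expr_div_n; lra.
Qed.

Lemma periodicz (f : R -> R) (T : R) : periodic f T ->
  forall (k : int) x, f (x + k%:~R * T) = f x.
Proof.
move=> fT [n|n] x; first by rewrite mulrC mulr_natr periodicn.
rewrite NegzE mulrNz mulNr -(periodicn fT n.+1 (x - _)).
by rewrite -mulr_natl subrK.
Qed.

Lemma chord_mod_le x y (k : int) :
  (cos x - cos y) ^+ 2 + (sin x - sin y) ^+ 2 <= (x - y - k%:~R * (pi *+ 2)) ^+ 2.
Proof.
rewrite -[cos y](periodicz (@cosD2pi R) k) -[sin y](periodicz (@sinD2pi R) k).
by rewrite (le_trans (chord_sqr_le _ _))// opprD addrA.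
Qed.

End Chord.

Section Transfer.
Variables (R : realType) (lambda1 lambda2 : R).
Hypotheses (l1P : 0 <= lambda1 <= 1) (l2P : 0 <= lambda2 <= 1).
Local Open Scope complex_scope.
Local Notation site := (int * bool)%type.
Implicit Types (f g : site -> R[i]).

(** The difference of two coins at a site is a scaled rotation, whose ratio is
    [l] times the chord between the two phases. *)
Lemma sqnorm_coinB l (phi phi' : int -> R) (M : R) f : 0 <= l <= 1 ->
  (forall n, (forall b, f (n, b) = 0) \/
    (cos (phi n) - cos (phi' n)) ^+ 2 + (sin (phi n) - sin (phi' n)) ^+ 2
      <= M ^+ 2) ->
  (sqnorm (fun i => coin l phi f i - coin l phi' f i)%R
   <= (M ^+ 2)%:E * sqnorm f)%E.
Proof.
move=> /andP[l0 l1] fM.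
rewrite /sqnorm -esumZ ?sqr_ge0//; last by move=> i; rewrite lee_fin sqr_ge0.
apply: (@esum_pairing _ _ (@flip) (fun i => normc (coin l phi f i - coin l phi' f i) ^+ 2)
  (fun i => M ^+ 2 * normc (f i) ^+ 2)).
- exact: flip_bij.
- by move=> i; exact: sqr_ge0.
- by move=> i; rewrite mulr_ge0// sqr_ge0.
move=> [n b].
wlog -> : b / b = true.
  move=> W; have [->|->] : b = true \/ b = false by case: b; [left|right].
    exact: W.
  by move: (W true erefl); rewrite /flip /= addrC [leRHS]addrC.
rewrite /flip /coin /= -mulrDr.
have [f0|] := fM n.
  by rewrite !f0 !(mulr0, subr0, addr0) normc0 expr0n /= !(mulr0, addr0).
rewrite !normc_sqr.
set c := cos (phi n); set s := sin (phi n).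
set c' := cos (phi' n); set s' := sin (phi' n) => cs.
case: (f (n, true)) => a1 a2; case: (f (n, false)) => b1 b2 /=.
set X := (X in X <= _).
have -> : X = l ^+ 2 * ((c - c') ^+ 2 + (s - s') ^+ 2) *
    (a1 ^+ 2 + a2 ^+ 2 + (b1 ^+ 2 + b2 ^+ 2)) by rewrite /X; ring.
apply: ler_wpM2r; first by rewrite !addr_ge0 ?sqr_ge0.
apply: le_trans cs; apply: ler_piMl; first by rewrite addr_ge0 ?sqr_ge0.
by rewrite expr_le1.
Qed.

Definition translate (d : int) f : site -> R[i] := fun i => f (i.1 + d, i.2).

Lemma translate_bij (d : int) : bijective (fun i : site => (i.1 + d, i.2)).
Proof. by exists (fun i => (i.1 - d, i.2)) => -[n b] /=; rewrite ?addrK ?subrK. Qed.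

Lemma sqnorm_translate d f : sqnorm (translate d f) = sqnorm f.
Proof.
rewrite /sqnorm [RHS](@reindex_esum R _ _ setT setT (fun i : site => (i.1 + d, i.2)))//.
by rewrite setTT_bijective; exact: translate_bij.
Qed.

Lemma coin_translate l (phi : int -> R) d f i :
  translate d (coin l phi f) i = coin l (fun n => phi (n + d)) (translate d f) i.
Proof. by case: i. Qed.

Lemma gshift_translate l d g i :
  translate d (gshift l g) i = gshift l (translate d g) i.
Proof. by case: i => n b; rewrite /translate /gshift /= (addrAC n (-1) d) (addrAC n 1 d). Qed.

Lemma gshiftB l f g i :
  gshift l f i - gshift l g i = gshift l (fun j => f j - g j) i.
Proof. by case: i => n []; rewrite /gshift; ring. Qed.

(** The localized vector is translated from [m] to [m']. As [gshift] commutes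
    with translations, the new error is the old one plus the image under [gshift]
    of a difference of coins, supported in the window. *)
Lemma spectrum_transfer (alpha theta : R) (z : R[i]) (L : nat) :
  (0 < L)%N -> spectrum (uamo lambda1 lambda2 alpha theta) z ->
  exists m : int, forall (beta theta' delta : R) (m' k : int),
    `|m%:~R * alpha + theta - (m'%:~R * beta + theta') - k%:~R| <= delta ->
    exists2 w, spectrum (uamo lambda1 lambda2 beta theta') w &
      normc (z - w) <= 7 / L%:R + 4 * pi * (delta + L%:R * `|alpha - beta|).
Proof.
move=> L0 zW; have [m [f [fs fz]]] := localized_approx_eigenvector l1P l2P L0 zW.
exists m => beta theta' delta m' k md.
set W := uamo _ _ _ _ in fz; set W' := uamo _ _ _ _.
have z1 : normc z = 1.
  apply: (@spectrum_unit_circle R _ W) => //.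
    by move=> x; exact: nsq_uamo.
  by move=> y; exact: uamo_surjective.
pose d := m - m'.
have FS : translate d f \in square_summable (R := R) (I := site).
  by apply/square_summableP; rewrite sqnorm_translate; apply/square_summableP; exact: valP.
pose F := L2 FS.
have nF : nsq F = nsq f by apply: EFin_inj; rewrite !nsqE sqnorm_translate.
pose D := delta + L%:R * `|alpha - beta|.
have D0 : 0 <= D by rewrite addr_ge0 ?(le_trans _ md)// mulr_ge0 ?ler0n.
pose M := 2 * pi * D.
pose phi n := phase alpha theta (n + d).
have decomp : sqnorm (W' F - z *: F) = sqnorm (fun i =>
    translate d (fun i => W f i - z * f i) i +
    gshift lambda1 (fun j => coin lambda2 (phase beta theta') F j
                             - coin lambda2 phi F j) i)%R.
  congr sqnorm; apply/funext => i.
  rewrite -gshiftB -[RHS]/(translate d (uamo_fun lambda1 lambda2 alpha theta f) i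
    - z * F i + (gshift lambda1 (coin lambda2 (phase beta theta') F) i
    - gshift lambda1 (coin lambda2 phi F) i)).
  rewrite -[LHS]/(uamo_fun lambda1 lambda2 beta theta' F i - z * F i).
  rewrite !uamo_fun_factor gshift_translate.
  have -> : translate d (coin lambda2 (phase alpha theta) f) = coin lambda2 phi F.
    by apply/funext => j; rewrite coin_translate.
  have alg (X Y Z : R[i]) : Y - Z = X - Z + (Y - X) by ring.
  exact: alg.
have coinM : (sqnorm (fun j => coin lambda2 (phase beta theta') F j
                             - coin lambda2 phi F j)%R <= (M ^+ 2)%:E * sqnorm F)%E.
  apply: sqnorm_coinB => // n.
  have [nL|nL] := leqP L `|(n - m')%R|%N.
    left=> b; rewrite [LHS]/(f (n + d, b)); apply: fs.
    by rewrite (_ : n + d - m = n - m') // /d; lia.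
  right; apply: (le_trans (chord_mod_le _ _ (- k))).
  (* The two phases at [n] differ, up to [k] turns, by the mismatch at the
     centres plus the drift accumulated over [n - m'] steps. *)
  have -> : phase beta theta' n - phi n - (- k)%:~R * (pi *+ 2) =
      - (2 * pi * (m%:~R * alpha + theta - (m'%:~R * beta + theta') - k%:~R
           + (n - m')%:~R * (alpha - beta))).
    by rewrite /phi /phase /d !(rmorphD, rmorphN, rmorphB) /= -mulr_natr; ring.
  rewrite sqrrN /M exprMn [leRHS]exprMn ler_wpM2l ?sqr_ge0//.
  rewrite -real_normK ?num_real// lerXn2r ?nnegrE//.
  rewrite (le_trans (ler_normD _ _))// lerD// normrM ler_wpM2r//.
  by rewrite -intr_norm -abszE -pmulrn ler_nat ltnW.
have x0 : 0 < L%:R :> R by rewrite ltr0n.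
have M0 : 0 <= M by rewrite !mulr_ge0 ?pi_ge0.
have NF : nsq (W' F - z *: F) <= (40 / L%:R ^+ 2 + 2 * M ^+ 2) * nsq F.
  rewrite -lee_fin nsqE decomp; apply: (le_trans (sqnormD_le _ _ ltr01)).
  rewrite invr1 sqnorm_translate sqnorm_gshift//.
  rewrite -[sqnorm (fun i => W f i - z * f i)%R]/(sqnorm (W f - z *: f)) -nsqE.
  rewrite mulrDl (EFinD (40 / _ * _)); apply: leeD.
    by rewrite -EFinM lee_fin nF; lra.
  rewrite -mulrA !EFinM nsqE; exact: lee_wpmul2l.
apply: (@spectrum_near_approx_eigenvector R _ W' _ _ z F) => //.
- by move=> x; exact: nsq_uamo.
- by move=> y; exact: uamo_surjective.
- apply: contraTneq fz => F0; rewrite -leNgt -nF F0 nsq0 mulr0; exact: nsq_ge0.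
- rewrite nrm_leP ?mulr_ge0 ?nrm_ge0 ?addr_ge0 ?divr_ge0 ?ler0n// ?exprMn;
    last by rewrite !mulr_ge0 ?pi_ge0.
  (* The square of [7 / L + 2 M] is at least [49 / L^2 + 4 M^2]. *)
  rewrite nrm_sqr (le_trans NF)// ler_wpM2r ?nsq_ge0//.
  rewrite (_ : 4 * pi * D = 2 * M); last by rewrite /M; ring.
  rewrite -[40 / _]mulrC -exprVn; have : 0 <= L%:R^-1 :> R by rewrite invr_ge0 ltW.
  move: (L%:R^-1) => t t0; have := mulr_ge0 t0 M0; nra.
Qed.

End Transfer.

(** * Hausdorff distances *)

Section Hausdorff.
Variable R : realType.
Implicit Types (A B : set R[i]).

Lemma normcB (z w : R[i]) : normc (z - w) = normc (w - z).
Proof. by rewrite -normcN opprB. Qed.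

Lemma hausdorff_dist_le A B (r : R) :
  (forall e : R, 0 < e -> forall a, A a -> exists2 b, B b & normc (a - b) <= r + e) ->
  (forall e : R, 0 < e -> forall b, B b -> exists2 a, A a & normc (b - a) <= r + e) ->
  (hausdorff_dist A B <= r%:E)%E.
Proof.
move=> AB BA; rewrite /hausdorff_dist ge_max; apply/andP; split.
  apply: ge_ereal_sup => _ [a Aa <-]; apply/lee_addgt0Pr => e e0.
  have [b Bb ab] := AB e e0 a Aa; rewrite -EFinD.
  apply: le_trans (_ : (normc (a - b))%:E <= _)%E; last by rewrite lee_fin.
  by apply: ereal_inf_lbound; exists b.
apply: ge_ereal_sup => _ [b Bb <-]; apply/lee_addgt0Pr => e e0.
have [a Aa ab] := BA e e0 b Bb; rewrite -EFinD.
apply: le_trans (_ : (normc (a - b))%:E <= _)%E; last by rewrite normcB lee_fin.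
by apply: ereal_inf_lbound; exists a.
Qed.

End Hausdorff.

Lemma closure_approx (K : numFieldType) (A : set K) (z e : K) :
  closure A z -> 0 < e -> exists2 w, A w & `|z - w| < e.
Proof.
move=> Az e0; have [w [Aw zw]] := Az _ (nbhsx_ballx z _ e0); by exists w.
Qed.

(** * Choice of the centre and of the width of the window *)

(** With [j = floor (m alpha q)], the number [j / q] is within [1 / q] of
    [m alpha], and the Bezout relation writes [j / q] as [m' p / q + k]. *)
Lemma near_rational (R : realType) (alpha theta : R) (p q : nat) (m : int) :
  (0 < q)%N -> coprime p q ->
  exists m' k : int, `|m%:~R * alpha + theta - (m'%:~R * (p%:R / q%:R) + theta)
                       - k%:~R| <= q%:R^-1.
Proof.
move=> q0 pq; have x0 : 0 < q%:R :> R by rewrite ltr0n.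
have [u [v uv]] := Bezoutz p%:Z q%:Z.
pose j := Num.floor (m%:~R * alpha * q%:R).
have uvj : (u * j) * p%:Z + (v * j) * q%:Z = j.
  by rewrite -!(mulrAC _ _ j) -mulrDl uv /gcdz !absz_nat (eqP pq) mul1r.
exists (u * j), (v * j).
have -> : m%:~R * alpha + theta - ((u * j)%:~R * (p%:R / q%:R) + theta) - (v * j)%:~R
    = (m%:~R * alpha * q%:R - j%:~R) / q%:R.
  rewrite -[in RHS]uvj intrD !intrM /=; field; rewrite gt_eqF//.
rewrite normrM normfV (ger0_norm (ltW x0)) ler_piMl ?invr_ge0 ?(ltW x0)//.
by rewrite ger0_norm ?subr_ge0 ?floor_le// lerBlDl ltW// -intrD1 floorD1_gt.
Qed.

(** [m p / q] depends modulo 1 only on the residue of [m], which is small enough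
    for the drift [m' `|p / q - alpha|] to stay below [1 / q]. *)
Lemma rational_near (R : realType) (alpha theta : R) (p q : nat) (m : int) :
  (0 < q)%N -> `|p%:R / q%:R - alpha| <= q%:R ^- 2 ->
  exists m' k : int, `|m%:~R * (p%:R / q%:R) + theta - (m'%:~R * alpha + theta)
                       - k%:~R| <= q%:R^-1.
Proof.
move=> q0 pqa; have x0 : 0 < q%:R :> R by rewrite ltr0n.
exists (m %% q)%Z, ((m %/ q)%Z * p).
have -> : m%:~R * (p%:R / q%:R) + theta - ((m %% q)%Z%:~R * alpha + theta)
    - ((m %/ q)%Z * p)%:~R = (m %% q)%Z%:~R * (p%:R / q%:R - alpha) :> R.
  rewrite {1}(divz_eq m q) intrD !intrM /=; field; rewrite gt_eqF//.
rewrite normrM (le_trans (ler_wpM2l _ pqa))// invfM mulrA ler_piMl ?invr_ge0 ?(ltW x0)//.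
rewrite ler_pdivrMr// mul1r ger0_norm; last by rewrite ler0z modz_ge0; lia.
by rewrite -[q%:R]/(q%:Z%:~R) ler_int ltW// ltz_pmod.
Qed.

Section Continuity.
Variables (R : realType) (lambda1 lambda2 : R).
Hypotheses (l1P : 0 <= lambda1 <= 1) (l2P : 0 <= lambda2 <= 1).
Local Notation W := (uamo lambda1 lambda2).

(** The phase [theta'] is the one for which the two walks agree at the centre
    [m]; the errors [1 / L] and [L `|alpha - beta|] balance at
    [L = `|alpha - beta|^(-1/2)]. *)
Lemma uamo_spectrum_holder (alpha beta : R) z (e : R) :
  0 <= alpha <= 1 -> 0 <= beta <= 1 -> 0 < e ->
  uamo_spectrum lambda1 lambda2 alpha z ->
  exists2 w, uamo_spectrum lambda1 lambda2 beta w &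
    normc (z - w) <= (14 + 4 * pi) * `|alpha - beta| `^ 2^-1 + e.
Proof.
move=> aP bP e0 za; have C0 : 0 <= 14 + 4 * pi :> R.
  by rewrite addr_ge0// mulr_ge0 ?pi_ge0.
have [->|ab] := eqVneq beta alpha.
  exists z => //; rewrite (subrr z) normc0 addr_ge0 ?(ltW e0)// mulr_ge0//.
rewrite powR12_sqrt//.
set s := Num.sqrt _.
have d0 : 0 < `|alpha - beta| by rewrite normr_gt0 subr_eq0 eq_sym.
have s0 : 0 < s by rewrite sqrtr_gt0.
have ds : `|alpha - beta| = s ^+ 2 by rewrite sqr_sqrtr.
have s1 : s <= 1.
  rewrite -(ler_pXn2r (n := 2)) ?nnegrE ?(ltW s0)// expr1n -ds ler_norml.
  by move: aP bP => /andP[? ?] /andP[? ?]; lra.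
have e0' : 0 < e%:C%C by rewrite ltcR.
have [z' [theta thP z'W] zz'] := closure_approx za e0'.
have {}zz' : normc (z - z') <= e by rewrite -lecR ltW.
have [L /andP[Ls sL]] : exists L : nat, L%:R <= s^-1 < L.+1%:R.
  by exists (Num.trunc s^-1); apply: truncn_itv; rewrite invr_ge0 ltW.
have L0 : (0 < L)%N.
  by rewrite -ltnS -(ltr_nat R) (le_lt_trans _ sL)// invf_ge1.
have [m mP] := spectrum_transfer l1P l2P L0 z'W.
pose k := Num.floor (m%:~R * (alpha - beta) + theta).
pose theta' := m%:~R * (alpha - beta) + theta - k%:~R.
have [w wW z'w] : exists2 w, spectrum (W beta theta') w &
    normc (z' - w) <= 7 / L%:R + 4 * pi * (0 + L%:R * `|alpha - beta|).
  apply: (mP beta theta' 0 m k).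
  rewrite (_ : _ - _ - _ = 0) ?normr0// /theta'; ring.
exists w.
  apply: subset_closure; exists theta' => //=.
  rewrite in_itv /= /theta' subr_ge0 floor_le /= ltrBlDl.
  by have := floorD1_gt (m%:~R * (alpha - beta) + theta); rewrite intrD.
rewrite -(subrK z' z) -addrA (le_trans (normc_triangle _ _))// [leRHS]addrC lerD//.
rewrite (le_trans z'w)// add0r ds (mulrDl 14).
have xs : 0 < L%:R :> R by rewrite ltr0n.
apply: lerD.
  have sLL : s^-1 < L%:R + L%:R.
    apply: (lt_le_trans sL).
    rewrite -natrD ler_nat.
    by rewrite -addn1 leq_add2l.
  move: sLL.
  rewrite -(ltr_pM2l s0) divff ?gt_eqF// ler_pdivrMr// => ?; lra.
rewrite ler_wpM2l ?mulr_ge0 ?pi_ge0//.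
rewrite expr2 mulrA -[leRHS]mul1r ler_wpM2r ?(ltW s0)//.
by rewrite -ler_pdivlMr// div1r.
Qed.

(** At equal frequencies no drift accumulates along the window, so [L] can be
    taken as large as [1 / `|theta - rho|]. *)
Lemma phase_lipschitz (alpha theta rho : R) z : spectrum (W alpha theta) z ->
  exists2 w, spectrum (W alpha rho) w &
    normc (z - w) <= (7 + 4 * pi) * `|theta - rho|.
Proof.
move=> zW.
have [->|tr] := eqVneq rho theta.
  by exists z => //; rewrite !subrr normc0 normr0 mulr0.
set d := `|theta - rho|.
have d0 : 0 < d by rewrite normr_gt0 subr_eq0 eq_sym.
have [L L0 dL] : exists2 L : nat, (0 < L)%N & d^-1 < L%:R.
  exists (Num.trunc d^-1).+1 => //.
  by have /andP[] : (Num.trunc d^-1)%:R <= d^-1 < (Num.trunc d^-1).+1%:R;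
    first by apply: truncn_itv; rewrite invr_ge0 ltW.
have [m mP] := spectrum_transfer l1P l2P L0 zW.
have [w wW zw] : exists2 w, spectrum (W alpha rho) w &
    normc (z - w) <= 7 / L%:R + 4 * pi * (d + L%:R * `|alpha - alpha|).
  by apply: (mP alpha rho d m 0); rewrite subr0 opprD addrACA subrr add0r.
exists w => //; rewrite (le_trans zw)// subrr normr0 mulr0 addr0.
rewrite (mulrDl 7) lerD2r ler_wpM2l//.
by rewrite -[leRHS]invrK lef_pV2 ?posrE ?invr_gt0 ?ltr0n// ltW.
Qed.

(** A window of half-width [L = q] makes the cut-off error, the mismatch and the
    drift all of order [1 / q]. *)
Lemma rational_transfer (alpha beta theta : R) (q : nat) z :
  (0 < q)%N -> `|alpha - beta| <= q%:R ^- 2 ->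
  (forall m : int, exists m' k : int,
    `|m%:~R * alpha + theta - (m'%:~R * beta + theta) - k%:~R| <= q%:R^-1) ->
  spectrum (W alpha theta) z ->
  exists2 w, spectrum (W beta theta) w &
    normc (z - w) <= (7 + 8 * pi) / Num.sqrt q%:R.
Proof.
move=> q0 ab near zW.
have [m mP] := spectrum_transfer l1P l2P q0 zW.
have [m' [k mk]] := near m.
have [w wW zw] := mP beta theta _ m' k mk.
exists w => //; rewrite (le_trans zw)//.
have x0 : 0 < q%:R :> R by rewrite ltr0n.
have x1 : 1 <= q%:R :> R by rewrite ler1n.
have qs : q%:R^-1 <= (Num.sqrt q%:R)^-1 :> R.
  rewrite lef_pV2 ?posrE ?sqrtr_gt0// -[leRHS](sqr_sqrtr (ltW x0)) expr2.
  by rewrite ler_peMl ?sqrtr_ge0// -[leLHS]sqrtr1 ler_wsqrtr.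
have qab : q%:R * `|alpha - beta| <= q%:R^-1.
  by rewrite -ler_pdivlMl// -invfM -expr2.
apply: (@le_trans _ _ ((7 + 8 * pi) / q%:R)); last first.
  by rewrite ler_wpM2l// addr_ge0// mulr_ge0 ?pi_ge0.
rewrite (mulrDl 7) lerD2l.
have -> : 8 * pi / q%:R = 4 * pi * (q%:R^-1 + q%:R^-1) :> R by ring.
by rewrite ler_wpM2l ?mulr_ge0 ?pi_ge0// lerD2l.
Qed.

End Continuity.

Theorem proposition4p10 (R : realType) (lambda1 lambda2 : R)
    (hlambda1 : 0 <= lambda1 <= 1) (hlambda2 : 0 <= lambda2 <= 1) :
  [/\ exists C : R, 0 < C /\
        forall alpha beta : R, 0 <= alpha <= 1 -> 0 <= beta <= 1 ->
        (hausdorff_dist (uamo_spectrum lambda1 lambda2 alpha)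
                        (uamo_spectrum lambda1 lambda2 beta)
         <= (C * `|alpha - beta| `^ 2^-1)%:E)%E,
      forall alpha : R, 0 <= alpha <= 1 ->
        exists C : R, 0 < C /\
        forall theta rho : R, 0 <= theta < 1 -> 0 <= rho < 1 ->
        (hausdorff_dist (spectrum (uamo lambda1 lambda2 alpha theta))
                        (spectrum (uamo lambda1 lambda2 alpha rho))
         <= (C * `|theta - rho| `^ 2^-1)%:E)%E &
      exists C : R, 0 < C /\
        forall (theta alpha beta : R) (p q : nat),
        0 <= theta < 1 -> 0 <= alpha <= 1 -> 0 <= beta <= 1 ->
        (0 < q)%N -> coprime p q -> beta = p%:R / q%:R ->
        `|alpha - beta| < 1 / q%:R ^+ 2 ->
        (hausdorff_dist (spectrum (uamo lambda1 lambda2 alpha theta))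
                        (spectrum (uamo lambda1 lambda2 beta theta))
         <= (C / Num.sqrt q%:R)%:E)%E].
Proof.
have C0 (a b : R) : 0 < a -> 0 <= b -> 0 < a + b * pi.
  by move=> a0 b0; rewrite ltr_pwDl// mulr_ge0 ?pi_ge0.
split.
- exists (14 + 4 * pi); split; first exact: C0.
  move=> alpha beta aP bP; apply: hausdorff_dist_le => e e0 z zW.
    exact: uamo_spectrum_holder zW.
  by rewrite distrC; exact: uamo_spectrum_holder zW.
- move=> alpha _; exists (7 + 4 * pi); split; first exact: C0.
  have C1 : 0 <= 7 + 4 * pi :> R by exact/ltW/C0.
  have sqrt_ge (d : R) : 0 <= d <= 1 -> d <= d `^ 2^-1.
    move=> /andP[d0 d1]; rewrite powR12_sqrt// -[leLHS](sqr_sqrtr d0) expr2.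
    by rewrite ler_piMl ?sqrtr_ge0// -[leRHS]sqrtr1 ler_wsqrtr.
  have dist1 (s t : R) : 0 <= s < 1 -> 0 <= t < 1 -> 0 <= `|s - t| <= 1.
    move=> /andP[? ?] /andP[? ?]; rewrite normr_ge0 ler_norml /=; lra.
  move=> theta rho tP rP; apply: hausdorff_dist_le => e e0 z zW.
    have [w wW zw] := phase_lipschitz hlambda1 hlambda2 rho zW.
    exists w => //; rewrite (le_trans zw)// ler_wpDr ?(ltW e0)// ler_wpM2l//.
    exact/sqrt_ge/dist1.
  have [w wW zw] := phase_lipschitz hlambda1 hlambda2 theta zW.
  exists w => //; rewrite (le_trans zw)// ler_wpDr ?(ltW e0)// ler_wpM2l//.
  by rewrite distrC; exact/sqrt_ge/dist1.
exists (7 + 8 * pi); split; first exact: C0.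
move=> theta alpha beta p q tP aP bP q0 pq bE; rewrite div1r => /ltW ab.
apply: hausdorff_dist_le => e e0 z zW.
  have [m|w wW zw] := rational_transfer hlambda1 hlambda2 q0 ab _ zW.
    by rewrite bE; exact: near_rational.
  by exists w => //; rewrite (le_trans zw)// lerDl ltW.
rewrite distrC in ab.
have [m|w wW zw] := rational_transfer hlambda1 hlambda2 q0 ab _ zW.
  by rewrite bE in ab *; exact: rational_near.
by exists w => //; rewrite (le_trans zw)// lerDl ltW.
Qed.
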